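(* Let $D=\left(\frac{a,\pi}{K}\right)$ be a quaternion division algebra over $K$ with $a\in\mathcal{O}_K^*$, with $K$-basis $1,x,y,z$ where $x^2=a$, $y^2=\pi$, $z=xy=-yx$, and let $\tau$ be its canonical involution. Take $\epsilon=1$, $\sigma=\tau_x$ and $\pi'=y$, so that $\sigma_{\pi'}=\tau_z$ and $\overline{\sigma_{\pi'}}=\mathrm{id}$. Then Larmour's isomorphism $\partial=(\partial_0,\partial_1)$ is an isomorphism $$W^{1}\left(\left(\tfrac{a,\pi}{K}\right),\tau_x\right)\cong W^{1}(k(\overline x),\iota)\oplus W(k(\overline x)),$$ given on one-dimensional forms as follows. Any one-dimensional unramified hermitian form can be diagonalized as $\langle\delta\rangle$ with $\delta\in\mathcal{O}_K^*$, and its image under $\partial_0$ is $\langle\overline\delta\rangle$. Any one-dimensional ramified hermitian form can be diagonalized as $\langle\beta y+\gamma z\rangle$, where $\beta,\gamma\in\mathcal{O}_K$ and $\beta+\gamma x$ is a unit (of the valuation ring) of the field $K(x)$, and its image under $\partial_1$ is the quadratic form $\langle\overline\beta+\overline\gamma\,\overline x\rangle$.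
   Context: $K$ is a complete discretely valued field with normalized valuation $\nu_K$, valuation ring $\mathcal{O}_K$, uniformizer $\pi$ and residue field $k$ of characteristic $\neq2$. $\nu_D(d)=\frac12\nu_K(\mathrm{Nrd}(d))$ extends $\nu_K$ to $D$; $\mathcal{O}_D=\{\nu_D\ge0\}$, $m_D=\{\nu_D>0\}$ (both with $0$), $\overline D=\mathcal{O}_D/m_D$, and a bar denotes reduction modulo $m_D$. Here $\nu_D$ has value group $\frac12\mathbb{Z}$ and $\overline D\cong k(\overline x)$, a quadratic field extension of $k$ with $\overline x^2=\overline a$; $\iota$ is its nontrivial $k$-automorphism. Every $K$-linear involution $\sigma$ of $D$ induces an involution $\overline\sigma$ on $\overline D$. $\tau(x)=-x$, $\tau(y)=-y$, $\tau(z)=-z$. For $\lambda\in D^*$, $\sigma_\lambda(d)=\lambda\sigma(d)\lambda^{-1}$; one has $\overline{\tau_x}=\iota$. $W^\epsilon(E,\rho)$ is the Witt group of nondegenerate $\epsilon$-hermitian forms over a division algebra with involution $(E,\rho)$; for a field $F$, $W(F)=W^1(F,\mathrm{id})$ is the Witt group of quadratic forms; $\langle u_1,\dots,u_r\rangle$ is the diagonal form with $\rho(u_i)=\epsilon u_i$. Larmour's isomorphism: given an $\epsilon$-symmetric uniformizer $\pi'$ of $D$ (i.e. $\sigma(\pi')=\epsilon\pi'$ and $\nu_D(\pi')=\frac12$), every $\epsilon$-hermitian form over $(D,\sigma)$ is isometric to $h_0\perp h_1$ with $h_0=\langle u_1,\dots,u_p\rangle$, $\nu_D(u_i)=0$,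 and $h_1=\langle v_1,\dots,v_q\rangle$, $\nu_D(v_i)=\frac12$. A form isometric to such an $h_0$ (resp. $h_1$) is called unramified (resp. ramified). Set $\overline{h_0}=\langle\overline{u_1},\dots,\overline{u_p}\rangle$ and $\overline{h_1}=\langle\overline{v_1\pi'^{-1}},\dots,\overline{v_q\pi'^{-1}}\rangle$. Then $\partial:W^\epsilon(D,\sigma)\to W^\epsilon(\overline D,\overline\sigma)\oplus W^1(\overline D,\overline{\sigma_{\pi'}})$, $[h]\mapsto([\overline{h_0}],[\overline{h_1}])$, is Larmour's (well-defined) group isomorphism. *)

(* Defs.v *)
From HB Require Import structures.
From mathcomp Require Import all_boot all_order all_algebra all_field.
From mathcomp Require Import boolp ring.
Set Implicit Arguments.
Unset Strict Implicit.
Unset Printing Implicit Defensive.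
Import Order.TTheory GRing.Theory Num.Theory.
Local Open Scope ring_scope.
Local Open Scope quotient_scope.

(* [rho 1 = 1] follows from the other axioms. *)
Record involution (E : nzRingType) := Involution {
  inv_fun :> E -> E;
  invoD : {morph inv_fun : u v / u + v};
  invoM : forall u v, inv_fun (u * v) = inv_fun v * inv_fun u;
  invoK : involutive inv_fun
}.

Lemma invo0 (E : nzRingType) (rho : involution E) : rho 0 = 0.
Proof. by apply: (addrI (rho 0)); rewrite -invoD !addr0. Qed.

Lemma invoN (E : nzRingType) (rho : involution E) u : rho (- u) = - rho u.
Proof. by apply: (addrI (rho u)); rewrite -invoD !subrr invo0. Qed.

Lemma invo1 (E : nzRingType) (rho : involution E) : rho 1 = 1.
Proof.
have : rho (1 * rho 1) = rho (rho 1) by rewrite mul1r.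
by rewrite invoM !invoK mul1r.
Qed.

Lemma invoV (E : unitRingType) (rho : involution E) u :
  u \is a GRing.unit -> rho u^-1 = (rho u)^-1 /\ rho u \is a GRing.unit.
Proof.
move=> Uu.
have e1 : rho u^-1 * rho u = 1 by rewrite -invoM mulrV // invo1.
have e2 : rho u * rho u^-1 = 1 by rewrite -invoM mulVr // invo1.
have U : rho u \is a GRing.unit by apply/unitrP; exists (rho u^-1).
by split=> //; apply: (mulIr U); rewrite e1 mulVr.
Qed.

Definition id_invo (F : comNzRingType) : involution F :=
  @Involution F idfun (fun _ _ => erefl) (fun u v => mulrC u v)
    (fun _ => erefl).

(* [twist_fun sigma lam] is d |-> lam sigma(d) lam^-1, written sigma_lam. *)
Definition twist_fun (E : unitRingType) (sigma : E -> E) (lam : E) : E -> E :=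
  fun d => lam * sigma d / lam.

Section Twist.
Variables (E : unitRingType) (sigma : involution E) (lam : E).
Hypothesis Ulam : lam \is a GRing.unit.
Hypothesis slam : sigma lam = lam \/ sigma lam = - lam.

Fact twistD : {morph twist_fun sigma lam : u v / u + v}.
Proof. by move=> u v; rewrite /twist_fun invoD mulrDr mulrDl. Qed.

Fact twistM u v : twist_fun sigma lam (u * v) =
  twist_fun sigma lam v * twist_fun sigma lam u.
Proof. by rewrite /twist_fun invoM !mulrA mulrVK. Qed.

Fact twistK : involutive (twist_fun sigma lam).
Proof.
move=> u; rewrite /twist_fun !invoM invoK (invoV sigma Ulam).1.
case: slam => ->.
  by rewrite !mulrA mulrV // mul1r mulrK.
by rewrite invrN !(mulNr, mulrN) opprK !mulrA mulrV // mul1r mulrK.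
Qed.

Definition twist : involution E := Involution twistD twistM twistK.
End Twist.

(* A nondegenerate hermitian form over (E, rho), on the left E-vector space
   E^n.  When E is a division ring every finite-dimensional space is of this
   kind up to isomorphism.  Linearity is in the first variable, so that
   h (a u) (b v) = a (h u v) (rho b).  Passing to right vector spaces through
   rho changes neither the diagonal forms nor their isometries. *)
Record hform (E : nzRingType) (rho : involution E) := HForm {
  hdim : nat;
  hval :> 'rV[E]_hdim -> 'rV[E]_hdim -> E;
  hlinear : forall a u u' v, hval (a *: u + u') v = a * hval u v + hval u' v;
  hherm : forall u v, hval u v = rho (hval v u);
  hnondeg : forall u, (forall v, hval u v = 0) -> u = 0
}.

Definition isometric (E : nzRingType) (rho : involution E) (h h' : hform rho)
    : Prop :=
  exists f : {linear 'rV[E]_(hdim h) -> 'rV[E]_(hdim h')},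
    bijective f /\ forall u v, h' (f u) (f v) = h u v.

(* h admits a subspace N equal to its own orthogonal.  When 2 is invertible
   the metabolic forms are exactly the hyperbolic ones. *)
Definition metabolic (E : nzRingType) (rho : involution E) (h : hform rho)
    : Prop :=
  exists N : 'rV[E]_(hdim h) -> Prop,
    forall v, N v <-> (forall u, N u -> h u v = 0).

Section FormOps.
Variables (E : nzRingType) (rho : involution E).
Implicit Types h : hform rho.

Lemma hformDl h u u' v : h (u + u') v = h u v + h u' v.
Proof. by have := hlinear (h := h) 1 u u' v; rewrite scale1r mul1r. Qed.

Lemma hform0l h v : h 0 v = 0.
Proof. by apply: (addrI (h 0 v)); rewrite -hformDl !addr0. Qed.

Lemma hformNl h u v : h (- u) v = - h u v.
Proof. by apply: (addrI (h u v)); rewrite -hformDl !subrr hform0l. Qed.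

Lemma hform0r h v : h v 0 = 0.
Proof. by rewrite hherm hform0l invo0. Qed.

Fact hzero_nondeg (u : 'rV[E]_0) : (forall v : 'rV[E]_0, 0 = 0 :> E) -> u = 0.
Proof. by move=> _; apply: thinmx0. Qed.

Definition hzero : hform rho.
Proof.
refine (@HForm E rho 0 (fun _ _ => 0) _ _ hzero_nondeg).
- by move=> *; rewrite mulr0 addr0.
- by move=> *; rewrite invo0.
Defined.

Definition hsum_val h1 h2 (u v : 'rV[E]_(hdim h1 + hdim h2)) : E :=
  h1 (lsubmx u) (lsubmx v) + h2 (rsubmx u) (rsubmx v).

Fact hsum_linear h1 h2 a u u' v :
  @hsum_val h1 h2 (a *: u + u') v = a * hsum_val u v + hsum_val u' v.
Proof. by rewrite /hsum_val !linearP !hlinear mulrDr addrACA. Qed.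

Fact hsum_herm h1 h2 u v : @hsum_val h1 h2 u v = rho (hsum_val v u).
Proof. by rewrite /hsum_val invoD -!hherm. Qed.

Fact hsum_nondeg h1 h2 u : (forall v, @hsum_val h1 h2 u v = 0) -> u = 0.
Proof.
move=> hu; rewrite -[u]hsubmxK.
have -> : lsubmx u = 0.
  apply: hnondeg => v; have := hu (row_mx v 0).
  by rewrite /hsum_val row_mxKl row_mxKr hform0r addr0.
have -> : rsubmx u = 0; last by rewrite row_mx0.
apply: hnondeg => v; have := hu (row_mx 0 v).
by rewrite /hsum_val row_mxKl row_mxKr hform0r add0r.
Qed.

Definition hsum h1 h2 : hform rho :=
  HForm (@hsum_linear h1 h2) (@hsum_herm h1 h2) (@hsum_nondeg h1 h2).

Definition hopp h : hform rho.
Proof.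
refine (@HForm E rho (hdim h) (fun u v => - h u v) _ _ _).
- by move=> a u u' v; rewrite hlinear opprD mulrN.
- by move=> u v; rewrite invoN -hherm.
- by move=> u hu; apply: (@hnondeg _ _ h) => v; apply/eqP; rewrite -oppr_eq0 hu.
Defined.

(* Forms are Witt equivalent when they become isometric after adding metabolic
   forms, i.e. when their classes in the Grothendieck group of isometry classes
   agree modulo the metabolic forms. *)
Definition witt_eq h h' : Prop :=
  exists m m', [/\ metabolic m, metabolic m' &
                   isometric (hsum h m) (hsum h' m')].

Lemma isometric_refl h : isometric h h.
Proof. by exists (idfun : {linear _ -> _}); split=> //; exists id. Qed.

Lemma isometric_lin h h' (f : 'rV[E]_(hdim h) -> 'rV[E]_(hdim h')) g :
  linear f -> cancel f g -> cancel g f ->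
  (forall u v, h' (f u) (f v) = h u v) -> isometric h h'.
Proof.
move=> lf fg gf hf.
pose F := GRing.isLinear.Build _ _ _ _ f lf.
pose fl : {linear _ -> _} := HB.pack f F.
by exists fl; split=> //; exists g.
Qed.

Lemma isometric_sym h h' : isometric h h' -> isometric h' h.
Proof.
case=> f [[g fg gf] hf]; apply: (@isometric_lin _ _ g f) => //.
  by move=> a u v; rewrite -{1}[u]gf -{1}[v]gf -linearP fg.
by move=> u v; rewrite -hf !gf.
Qed.

Lemma isometric_trans h h' h'' :
  isometric h h' -> isometric h' h'' -> isometric h h''.
Proof.
case=> f [bf hf] [f' [bf' hf']]; exists (f' \o f : {linear _ -> _}).
by split=> [|u v]; [exact: bij_comp | rewrite /= hf' hf].
Qed.

Lemma hsum_isometric h1 h1' h2 h2' : isometric h1 h1' -> isometric h2 h2' ->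
  isometric (hsum h1 h2) (hsum h1' h2').
Proof.
case=> f [[f' ff' f'f] hf] [g [[g' gg' g'g] hg]].
apply: (@isometric_lin (hsum h1 h2) (hsum h1' h2')
  (fun u => row_mx (f (lsubmx u)) (g (rsubmx u)))
  (fun u => row_mx (f' (lsubmx u)) (g' (rsubmx u)))).
- by move=> a u v; rewrite !linearP -add_row_mx -scale_row_mx.
- by move=> u; rewrite row_mxKl row_mxKr ff' gg' hsubmxK.
- by move=> u; rewrite row_mxKl row_mxKr f'f g'g hsubmxK.
- by move=> u v; rewrite /= /hsum_val !row_mxKl !row_mxKr hf hg.
Qed.

Lemma hsumC h1 h2 : isometric (hsum h1 h2) (hsum h2 h1).
Proof.
apply: (@isometric_lin (hsum h1 h2) (hsum h2 h1)
  (fun u => row_mx (rsubmx u) (lsubmx u))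
  (fun u => row_mx (rsubmx u) (lsubmx u))).
- by move=> a u v; rewrite !linearP -add_row_mx -scale_row_mx.
- by move=> u; rewrite row_mxKl row_mxKr hsubmxK.
- by move=> u; rewrite row_mxKl row_mxKr hsubmxK.
- by move=> u v; rewrite /= /hsum_val !row_mxKl !row_mxKr addrC.
Qed.

Lemma hsumA h1 h2 h3 :
  isometric (hsum h1 (hsum h2 h3)) (hsum (hsum h1 h2) h3).
Proof.
apply: (@isometric_lin (hsum h1 (hsum h2 h3)) (hsum (hsum h1 h2) h3)
 
  (fun u => row_mx (row_mx (lsubmx u) (lsubmx (rsubmx u)))
                   (rsubmx (rsubmx u)))
  (fun u => row_mx (lsubmx (lsubmx u))
                   (row_mx (rsubmx (lsubmx u)) (rsubmx u)))).
- by move=> a u v; rewrite !linearP !(scale_row_mx, add_row_mx).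
- by move=> u; rewrite !(row_mxKl, row_mxKr) !hsubmxK.
- by move=> u; rewrite !(row_mxKl, row_mxKr) !hsubmxK.
- by move=> u v; rewrite /= /hsum_val /= /hsum_val !(row_mxKl, row_mxKr) addrA.
Qed.

Lemma hsum0 h : isometric (hsum h hzero) h.
Proof.
apply: (@isometric_lin (hsum h hzero) h
  (fun u => lsubmx u) (fun u => row_mx u 0)).
- by move=> a u v; rewrite linearP.
- move=> u; rewrite -[RHS]hsubmxK; congr row_mx.
  by rewrite (thinmx0 (rsubmx u)).
- by move=> u; rewrite row_mxKl.
- by move=> u v; rewrite /= /hsum_val /= addr0.
Qed.

Lemma hsumACA h1 h2 h3 h4 :
  isometric (hsum (hsum h1 h2) (hsum h3 h4)) (hsum (hsum h1 h3) (hsum h2 h4)).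
Proof.
apply: isometric_trans (isometric_sym (hsumA _ _ _)) _.
apply: isometric_trans (hsumA _ _ _).
apply: hsum_isometric (isometric_refl _) _.
apply: isometric_trans (hsumA _ _ _) _.
apply: isometric_trans (isometric_sym (hsumA _ _ _)).
apply: hsum_isometric (hsumC _ _) (isometric_refl _).
Qed.

Lemma metabolic_hzero : metabolic hzero.
Proof. by exists (fun _ => True). Qed.

Lemma metabolic_hsum h1 h2 :
  metabolic h1 -> metabolic h2 -> metabolic (hsum h1 h2).
Proof.
case=> N1 hN1 [N2 hN2].
exists (fun u => N1 (lsubmx u) /\ N2 (rsubmx u)) => v; split.
  case=> n1 n2 u [m1 m2]; rewrite /= /hsum_val.
  by rewrite ((hN1 _).1 n1) // ((hN2 _).1 n2) // addr0.
move=> hv; split.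
  apply/hN1 => u nu; have := hv (row_mx u 0).
  rewrite /= /hsum_val !row_mxKl !row_mxKr hform0l addr0; apply; split=> //.
  by apply/hN2 => w _; exact: hform0r.
apply/hN2 => u nu; have := hv (row_mx 0 u).
rewrite /= /hsum_val !row_mxKl !row_mxKr hform0l add0r; apply; split=> //.
by apply/hN1 => w _; exact: hform0r.
Qed.

Lemma metabolic_hopp h : metabolic (hsum (hopp h) h).
Proof.
exists (fun u => lsubmx u = rsubmx u) => v; split.
  by move=> e u eu; rewrite /= /hsum_val /= eu e addNr.
move=> hv; apply/eqP; rewrite -subr_eq0; apply/eqP/(@hnondeg _ _ h) => u.
have := hv (row_mx u u); rewrite row_mxKl row_mxKr => /(_ erefl).
rewrite /= /hsum_val /= !row_mxKl !row_mxKr => e.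
rewrite hformDl hformNl !(@hherm _ _ h _ u) -invoN -invoD.
by rewrite -[X in rho X]opprK opprB addrC e oppr0 invo0.
Qed.

Lemma isometric_witt h h' : isometric h h' -> witt_eq h h'.
Proof.
move=> hh; exists hzero, hzero; split; try exact: metabolic_hzero.
exact: hsum_isometric hh (isometric_refl _).
Qed.

Lemma metabolic_witt h : metabolic h -> witt_eq h hzero.
Proof.
by move=> mh; exists hzero, h; split=> //; [exact: metabolic_hzero|exact: hsumC].
Qed.

Lemma witt_eq_sym h h' : witt_eq h h' -> witt_eq h' h.
Proof. by case=> m [m' [? ? /isometric_sym ?]]; exists m', m. Qed.

Lemma witt_eq_trans h h' h'' : witt_eq h h' -> witt_eq h' h'' -> witt_eq h h''.
Proof.
case=> m1 [m2 [M1 M2 i12]] [m3 [m4 [M3 M4 i34]]].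
exists (hsum m1 m3), (hsum m4 m2); split; try exact: metabolic_hsum.
apply: isometric_trans (hsumA _ _ _) _.
apply: isometric_trans (hsum_isometric i12 (isometric_refl _)) _.
apply: isometric_trans (isometric_sym (hsumA _ _ _)) _.
apply: isometric_trans (hsum_isometric (isometric_refl _) (hsumC _ _)) _.
apply: isometric_trans (hsumA _ _ _) _.
apply: isometric_trans (hsum_isometric i34 (isometric_refl _)) _.
exact: isometric_sym (hsumA _ _ _).
Qed.

Lemma witt_eq_hsum h1 h1' h2 h2' : witt_eq h1 h1' -> witt_eq h2 h2' ->
  witt_eq (hsum h1 h2) (hsum h1' h2').
Proof.
case=> m1 [m2 [M1 M2 i12]] [m3 [m4 [M3 M4 i34]]].
exists (hsum m1 m3), (hsum m2 m4); split; try exact: metabolic_hsum.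
apply: isometric_trans (hsumACA _ _ _ _) _.
apply: isometric_trans (hsum_isometric i12 i34) _.
exact: hsumACA.
Qed.

End FormOps.

HB.instance Definition _ (E : nzRingType) (rho : involution E) :=
  gen_eqMixin (hform rho).
HB.instance Definition _ (E : nzRingType) (rho : involution E) :=
  gen_choiceMixin (hform rho).

Section WittGroup.
Variables (E : nzRingType) (rho : involution E).

Definition witt_rel (h h' : hform rho) : bool := `[< witt_eq h h' >].

Fact witt_rel_refl : reflexive witt_rel.
Proof. by move=> h; apply/asboolP/isometric_witt/isometric_refl. Qed.

Fact witt_rel_sym : symmetric witt_rel.
Proof. by move=> h h'; apply: asbool_equiv_eq; split; apply: witt_eq_sym. Qed.

Fact witt_rel_trans : transitive witt_rel.
Proof.
by move=> h2 h1 h3 /asboolP h12 /asboolP h23;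
  apply/asboolP/(witt_eq_trans h12 h23).
Qed.

Canonical witt_equiv := EquivRel witt_rel
  witt_rel_refl witt_rel_sym witt_rel_trans.

Definition witt := {eq_quot witt_rel}.
HB.instance Definition _ := Choice.on witt.
HB.instance Definition _ := Quotient.on witt.

Definition wclass (h : hform rho) : witt := \pi_witt h.

Lemma wclassP h h' : wclass h = wclass h' <-> witt_eq h h'.
Proof.
split=> [/eqmodP/asboolP //|hh]; exact/eqmodP/asboolP.
Qed.

Lemma wclass_repr w : wclass (repr w) = w.
Proof. exact: reprK. Qed.

Definition witt_zero : witt := wclass (hzero rho).
Definition witt_add (v w : witt) : witt := wclass (hsum (repr v) (repr w)).
Definition witt_opp (w : witt) : witt := wclass (hopp (repr w)).

Lemma witt_addE h h' : witt_add (wclass h) (wclass h') = wclass (hsum h h').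
Proof. by apply/wclassP/witt_eq_hsum; apply/wclassP; rewrite wclass_repr. Qed.

Fact witt_addA : associative witt_add.
Proof.
move=> u v w; rewrite -[u]wclass_repr -[v]wclass_repr -[w]wclass_repr.
by rewrite !witt_addE; apply/wclassP/isometric_witt/hsumA.
Qed.

Fact witt_addC : commutative witt_add.
Proof.
move=> u v; rewrite -[u]wclass_repr -[v]wclass_repr.
by rewrite !witt_addE; apply/wclassP/isometric_witt/hsumC.
Qed.

Fact witt_add0 : left_id witt_zero witt_add.
Proof.
move=> u; rewrite witt_addC -[u]wclass_repr.
by rewrite witt_addE; apply/wclassP/isometric_witt/hsum0.
Qed.

Fact witt_addN : left_inverse witt_zero witt_opp witt_add.
Proof.
move=> u; rewrite -[X in witt_add _ X]wclass_repr witt_addE.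
by apply/wclassP/metabolic_witt/metabolic_hopp.
Qed.

HB.instance Definition _ := GRing.isZmodule.Build witt
  witt_addA witt_addC witt_add0 witt_addN.

Lemma wclassD h h' : wclass (hsum h h') = wclass h + wclass h'.
Proof. by rewrite -witt_addE. Qed.

End WittGroup.

Definition sym_units (E : unitRingType) (rho : involution E) (s : seq E)
    : bool :=
  all (fun u => (rho u == u) && (u \is a GRing.unit)) s.

Section Diag.
Variables (E : unitRingType) (rho : involution E) (s : seq E).
Hypothesis s_ok : sym_units rho s.

Definition diag_val (u v : 'rV[E]_(size s)) : E :=
  \sum_(i < size s) u 0 i * s`_i * rho (v 0 i).

Fact diag_linear a u u' v :
  diag_val (a *: u + u') v = a * diag_val u v + diag_val u' v.
Proof.
rewrite /diag_val mulr_sumr -big_split /=; apply: eq_bigr => i _.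
by rewrite !mxE !mulrDl !mulrA.
Qed.

Fact diag_herm u v : diag_val u v = rho (diag_val v u).
Proof.
rewrite /diag_val.
rewrite (big_morph (rho : E -> E) (@invoD _ rho) (invo0 rho)).
apply: eq_bigr => i _; rewrite !invoM invoK mulrA.
by have /andP[/eqP-> _] := all_nthP 0 s_ok i (ltn_ord i).
Qed.

Fact diag_nondeg u : (forall v, diag_val u v = 0) -> u = 0.
Proof.
move=> hu; apply/rowP=> i; rewrite mxE.
have /andP[_ Us] := all_nthP 0 s_ok i (ltn_ord i).
have := hu (delta_mx 0 i); rewrite /diag_val (bigD1 i) //= big1 ?addr0.
  by rewrite mxE !eqxx invo1 mulr1 => e; apply: (mulIr Us); rewrite e mul0r.
by move=> j /negbTE ji; rewrite mxE eqxx ji invo0 mulr0.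
Qed.

Definition diag_form : hform rho := HForm diag_linear diag_herm diag_nondeg.
End Diag.

(* The value of a valuation at 0 is irrelevant throughout. *)
Record normalized_valuation (K : fieldType) (nu : K -> int) : Prop :=
  NormalizedValuation {
    valM : forall c d, c != 0 -> d != 0 -> nu (c * d) = nu c + nu d;
    valD : forall c d, c != 0 -> d != 0 -> c + d != 0 ->
             Num.min (nu c) (nu d) <= nu (c + d);
    val_surj : forall n : int, exists2 c, c != 0 & nu c = n
  }.

Definition val_ge (K : fieldType) (nu : K -> int) (n : int) (c : K) : bool :=
  (c == 0) || (n <= nu c).

Definition complete_valuation (K : fieldType) (nu : K -> int) : Prop :=
  forall s : nat -> K,
    (forall n : int, exists N, forall i j, (N <= i)%N -> (N <= j)%N ->
       val_ge nu n (s i - s j)) ->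
    exists l, forall n : int, exists N, forall i, (N <= i)%N ->
       val_ge nu n (s i - l).

Definition val_ring (A : nmodType) (V : numDomainType) (v : A -> V) : pred A :=
  fun d => (d == 0) || (0 <= v d).

Definition val_ideal (A : nmodType) (V : numDomainType) (v : A -> V) : pred A :=
  fun d => (d == 0) || (0 < v d).

(* [r] exhibits [B] as the residue ring O / m, where O = [val_ring v] and
   m = [val_ideal v]: restricted to O, it is a surjective ring morphism with
   kernel m.  Its values outside O are irrelevant. *)
Record residue_map (A : nzRingType) (V : numDomainType) (v : A -> V)
    (B : nzRingType) (r : A -> B) : Prop := ResidueMap {
  res1 : r 1 = 1;
  resD : {in val_ring v &, {morph r : c d / c + d}};
  resM : {in val_ring v &, {morph r : c d / c * d}};
  res_surj : forall b, exists2 c, c \in val_ring v & r c = b;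
  res_ker : forall c, c \in val_ring v -> (r c == 0) = (c \in val_ideal v)
}.

(* [Quat p q r s] is p + q x + r y + s z, where x^2 = a, y^2 = b and
   z = x y = - y x. *)
Record quat (K : fieldType) (a b : K) :=
  Quat { re1 : K; imx : K; imy : K; imz : K }.

Section Quaternions.
Variables (K : fieldType) (a b : K).
Local Notation Q := (quat a b).
Implicit Types c d e : Q.

Definition quat_to_tuple d := (re1 d, imx d, imy d, imz d).
Definition quat_of_tuple (t : K * K * K * K) : Q :=
  let: (t1, tx, ty, tz) := t in Quat a b t1 tx ty tz.
Fact quat_tupleK : cancel quat_to_tuple quat_of_tuple.
Proof. by case. Qed.

HB.instance Definition _ := Choice.copy Q (can_type quat_tupleK).

Lemma quatP c d : [/\ re1 c = re1 d, imx c = imx d, imy c = imy d &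
  imz c = imz d] <-> c = d.
Proof. by case: c d => ? ? ? ? [? ? ? ?] /=; split=> [[-> -> -> ->]|[]]. Qed.

Definition quat_zero : Q := Quat a b 0 0 0 0.
Definition quat_one : Q := Quat a b 1 0 0 0.
Definition quat_opp d : Q := Quat a b (- re1 d) (- imx d) (- imy d) (- imz d).
Definition quat_add c d : Q :=
  Quat a b (re1 c + re1 d) (imx c + imx d) (imy c + imy d) (imz c + imz d).
Definition quat_mul c d : Q := Quat a b
  (re1 c * re1 d + a * (imx c * imx d) + b * (imy c * imy d)
     - a * b * (imz c * imz d))
  (re1 c * imx d + imx c * re1 d - b * (imy c * imz d) + b * (imz c * imy d))
  (re1 c * imy d + imy c * re1 d + a * (imx c * imz d) - a * (imz c * imx d))
  (re1 c * imz d + imz c * re1 d + imx c * imy d - imy c * imx d).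
Definition quat_scale (t : K) d : Q :=
  Quat a b (t * re1 d) (t * imx d) (t * imy d) (t * imz d).

Fact quat_addA : associative quat_add.
Proof. by move=> c d e; apply/quatP; split=> /=; ring. Qed.
Fact quat_addC : commutative quat_add.
Proof. by move=> c d; apply/quatP; split=> /=; ring. Qed.
Fact quat_add0 : left_id quat_zero quat_add.
Proof. by move=> c; apply/quatP; split=> /=; ring. Qed.
Fact quat_addN : left_inverse quat_zero quat_opp quat_add.
Proof. by move=> c; apply/quatP; split=> /=; ring. Qed.
HB.instance Definition _ := GRing.isZmodule.Build Q
  quat_addA quat_addC quat_add0 quat_addN.

Fact quat_mulA : associative quat_mul.
Proof. by move=> c d e; apply/quatP; split=> /=; ring. Qed.
Fact quat_mul1l : left_id quat_one quat_mul.
Proof. by move=> c; apply/quatP; split=> /=; ring. Qed.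
Fact quat_mul1r : right_id quat_one quat_mul.
Proof. by move=> c; apply/quatP; split=> /=; ring. Qed.
Fact quat_mulDl : left_distributive quat_mul +%R.
Proof. by move=> c d e; apply/quatP; split=> /=; ring. Qed.
Fact quat_mulDr : right_distributive quat_mul +%R.
Proof. by move=> c d e; apply/quatP; split=> /=; ring. Qed.
Fact quat_one_neq0 : quat_one != 0.
Proof. by apply/eqP => /quatP[/eqP]; rewrite /= oner_eq0. Qed.
HB.instance Definition _ := GRing.Zmodule_isNzRing.Build Q
  quat_mulA quat_mul1l quat_mul1r quat_mulDl quat_mulDr quat_one_neq0.

Fact quat_scaleA s t d : quat_scale s (quat_scale t d) = quat_scale (s * t) d.
Proof. by apply/quatP; split=> /=; ring. Qed.
Fact quat_scale1 : left_id 1 quat_scale.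
Proof. by move=> c; apply/quatP; split=> /=; ring. Qed.
Fact quat_scaleDr : right_distributive quat_scale +%R.
Proof. by move=> t c d; apply/quatP; split=> /=; ring. Qed.
Fact quat_scaleDl d : {morph quat_scale^~ d : s t / s + t}.
Proof. by move=> s t; apply/quatP; split=> /=; ring. Qed.
HB.instance Definition _ := GRing.Zmodule_isLmodule.Build K Q
  quat_scaleA quat_scale1 quat_scaleDr quat_scaleDl.

Fact quat_scaleAl (t : K) c d : t *: (c * d) = t *: c * d.
Proof. by apply/quatP; split=> /=; ring. Qed.
HB.instance Definition _ := GRing.Lmodule_isLalgebra.Build K Q quat_scaleAl.
Fact quat_scaleAr (t : K) c d : t *: (c * d) = c * (t *: d).
Proof. by apply/quatP; split=> /=; ring. Qed.
HB.instance Definition _ := GRing.Lalgebra_isAlgebra.Build K Q quat_scaleAr.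

Definition quat_conj d : Q := Quat a b (re1 d) (- imx d) (- imy d) (- imz d).

(* The reduced norm: d * quat_conj d = (Nrd d)%:A. *)
Definition Nrd d : K :=
  re1 d ^+ 2 - a * imx d ^+ 2 - b * imy d ^+ 2 + a * b * imz d ^+ 2.

Lemma quat_mul_conj d : d * quat_conj d = (Nrd d)%:A.
Proof. by apply/quatP; split=> /=; rewrite /Nrd; ring. Qed.

Lemma quat_conj_mul d : quat_conj d * d = (Nrd d)%:A.
Proof. by apply/quatP; split=> /=; rewrite /Nrd; ring. Qed.

Lemma NrdM c d : Nrd (c * d) = Nrd c * Nrd d.
Proof. by rewrite /Nrd /=; ring. Qed.

Definition quat_unit : pred Q := fun d => Nrd d != 0.
Definition quat_inv d : Q :=
  if quat_unit d then (Nrd d)^-1 *: quat_conj d else d.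

Fact quat_mulV : {in quat_unit, left_inverse 1 quat_inv *%R}.
Proof.
move=> d Ud; rewrite /quat_inv [quat_unit d]Ud -scalerAl quat_conj_mul.
by rewrite scalerA mulVf // scale1r.
Qed.
Fact quat_divV : {in quat_unit, right_inverse 1 quat_inv *%R}.
Proof.
move=> d Ud; rewrite /quat_inv [quat_unit d]Ud -scalerAr quat_mul_conj.
by rewrite scalerA mulVf // scale1r.
Qed.
Fact quat_unitP c d : d * c = 1 /\ c * d = 1 -> quat_unit c.
Proof.
move=> [_ /(congr1 Nrd)]; rewrite NrdM /quat_unit => e; apply/negP => /eqP c0.
have /eqP : (1 : K) = 0 by rewrite -[RHS](mul0r (Nrd d)) -c0 e /Nrd /=; ring.
by rewrite oner_eq0.
Qed.
Fact quat_inv_out : {in [predC quat_unit], quat_inv =1 id}.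
Proof. by move=> d /negbTE Ud; rewrite /quat_inv [quat_unit d]Ud. Qed.
HB.instance Definition _ := GRing.NzRing_hasMulInverse.Build Q
  quat_mulV quat_divV quat_unitP quat_inv_out.

Definition qx : Q := Quat a b 0 1 0 0.
Definition qy : Q := Quat a b 0 0 1 0.
Definition qz : Q := Quat a b 0 0 0 1.

Lemma qxx : qx ^+ 2 = a%:A.
Proof. by apply/quatP; split=> /=; ring. Qed.
Lemma qyy : qy ^+ 2 = b%:A.
Proof. by apply/quatP; split=> /=; ring. Qed.
Lemma qxy : qx * qy = qz.
Proof. by apply/quatP; split=> /=; ring. Qed.
Lemma qyx : qy * qx = - qz.
Proof. by apply/quatP; split=> /=; ring. Qed.
Lemma quat_basis d : d = (re1 d)%:A + imx d *: qx + imy d *: qy + imz d *: qz.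
Proof. by apply/quatP; split=> /=; ring. Qed.

Fact quat_conjD : {morph quat_conj : c d / c + d}.
Proof. by move=> c d; apply/quatP; split=> /=; ring. Qed.
Fact quat_conjM c d : quat_conj (c * d) = quat_conj d * quat_conj c.
Proof. by apply/quatP; split=> /=; ring. Qed.
Fact quat_conjK : involutive quat_conj.
Proof. by move=> d; apply/quatP; split=> /=; ring. Qed.

Definition tau : involution Q := Involution quat_conjD quat_conjM quat_conjK.

Fact qx_unit : a != 0 -> qx \is a GRing.unit.
Proof.
by move=> a0; rewrite unfold_in /= /quat_unit /Nrd /= -oppr_eq0;
  apply: contra a0 => /eqP e; apply/eqP; rewrite -e; ring.
Qed.
Fact tau_qx : tau qx = - qx.
Proof. by apply/quatP; split=> /=; ring. Qed.

Definition tau_x (a0 : a != 0) : involution Q :=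
  twist (qx_unit a0) (or_intror tau_qx).

End Quaternions.

Arguments qx {K a b}.
Arguments qy {K a b}.
Arguments qz {K a b}.
Arguments tau {K a b}.

Definition nuD (K : fieldType) (nu : K -> int) (a b : K) (d : quat a b) : rat :=
  (nu (Nrd d))%:~R / 2%:R.

(* [sbar] is the involution induced on the residue ring by [sigma]. *)
Definition induces (A B : nzRingType) (V : numDomainType) (v : A -> V)
    (r : A -> B) (sigma : A -> A) (sbar : B -> B) : Prop :=
  forall d, d \in val_ring v -> r (sigma d) = sbar (r d).

Section Larmour.
Variables (D : unitRingType) (v : D -> rat) (sigma : involution D) (pi' : D).
Variables (B : unitRingType) (r : D -> B) (rho0 rho1 : involution B).

Definition diagonal_of_value (t : rat) (h : hform sigma) : Prop :=
  exists (s : seq D) (s_ok : sym_units sigma s),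
    {in s, forall u, v u = t} /\ isometric h (diag_form s_ok).

(* The case epsilon = 1 of an epsilon-symmetric uniformizer. *)
Definition symmetric_uniformizer : Prop := sigma pi' = pi' /\ v pi' = 1 / 2%:R.

Definition unramified : hform sigma -> Prop := diagonal_of_value 0.
Definition ramified : hform sigma -> Prop := diagonal_of_value (1 / 2%:R).

(* The two clauses determine [partial] uniquely. *)
Record larmour_map (partial : witt sigma -> witt rho0 * witt rho1) : Prop :=
  LarmourMap {
    larmour_decomposition : forall h : hform sigma, exists h0 h1,
      [/\ unramified h0, ramified h1 & isometric h (hsum h0 h1)];
    larmour_value : forall (us vs : seq D)
        (us_ok : sym_units sigma us) (vs_ok : sym_units sigma vs),
      {in us, forall u, v u = 0} -> {in vs, forall w, v w = 1 / 2%:R} ->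
      exists (us'_ok : sym_units rho0 [seq r u | u <- us])
             (vs'_ok : sym_units rho1 [seq r (w / pi') | w <- vs]),
        partial (wclass (hsum (diag_form us_ok) (diag_form vs_ok)))
          = (wclass (diag_form us'_ok), wclass (diag_form vs'_ok))
  }.
End Larmour.

(* Main.v *)
From HB Require Import structures.
Require Import Defs.
From mathcomp Require Import all_boot all_order all_algebra all_field.
From mathcomp Require Import boolp ring zify.
Set Implicit Arguments.
Unset Strict Implicit.
Unset Printing Implicit Defensive.
Import Order.TTheory GRing.Theory Num.Theory.
Local Open Scope ring_scope.

(** Larmour's isomorphism is built here as the inverse of a lifting map
    [W(k(xbar), iota) + W(k(xbar)) -> W(D, tau_x)], which sends the class of
    <c> to the class of <u>, where [u] is any symmetric element of [D] of value
    0 with residue [c] (first summand), or any symmetric [u] of value 1/2 such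
    that [u / y] has residue [c] (second summand).

    The choice of [u] does not matter, because of Hensel's lemma: a 1-unit [g]
    of [D] is a square in [K[g]] ([hensel_quat]), and applying this to
    [g = u' / u] shows that symmetric [u], [u'] with [u' / u] a 1-unit satisfy
    [u' = d u sigma(d)] ([congruent_scaling]), whence <u> and <u'> are
    isometric.

    The map respects Witt equivalence because the Witt group of a division ring
    with involution in which 2 is nonzero is presented by the classes of rank 1
    forms and three relations, in rank 1 and 2 ([witt_relations], [witt_lift]), each of which
    lifts from the residue field to [D] ([layer_scale], [layer_add],
    [layer_opp]).  The presentation holds because the relations alone reduce a
    diagonal form to an anisotropic one ([anisotropic_representative]), and an
    anisotropic form that is trivial in the Witt group is zero
    ([anisotropic_witt0]).

    The lifting map is surjective because a symmetric element can be rescaled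
    to have value 0 or 1/2 ([larmour_split]).  It is injective because lifts of
    anisotropic residue forms have an anisotropic orthogonal sum ([springer]),
    which is nonzero in the Witt group unless both forms are zero.

    The explicit one-dimensional forms come from the same uniqueness of lifts:
    [p + r y + s z] of value 0 has the same residue as [p], and if it has value
    1/2 then its quotient by [y] has the same residue as that of [r y + s z],
    namely [r + s x].

    All facts on [nu_D] rest on one: the residue of [a] is not a square,
    since otherwise Hensel's lemma would make [a] a square and [D] split.  So
    nonzero norms from [K(x)] have even value, and nonzero terms of
    [Nrd (e + f y) = N e - pi N f] never have the same value. *)

(** * Orthogonality over a division ring *)

Definition subspace (E : nzRingType) n (W : 'rV[E]_n -> Prop) : Prop :=
  W 0 /\ forall a u v, W u -> W v -> W (a *: u + v).

Lemma subspaceZ (E : nzRingType) n (W : 'rV[E]_n -> Prop) a u :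
  subspace W -> W u -> W (a *: u).
Proof. by case=> W0 Wl Wu; rewrite -[_ *: _]addr0; apply: Wl. Qed.

Lemma subspaceD (E : nzRingType) n (W : 'rV[E]_n -> Prop) u v :
  subspace W -> W u -> W v -> W (u + v).
Proof. by case=> W0 Wl Wu Wv; rewrite -[u]scale1r; apply: Wl. Qed.

Section DivisionRing.
Variables (E : unitRingType) (rho : involution E).
Hypothesis divE : forall d : E, d != 0 -> d \is a GRing.unit.

(** Enlarge [W] by one basis vector at a time as long as [v] stays outside.  In
    the end every basis vector is congruent to a multiple of [v] modulo the
    enlarged space, and these multiples are the coefficients of the
    functional. *)
Lemma separating_functional n (W : 'rV[E]_n -> Prop) (v : 'rV[E]_n) :
  subspace W -> ~ W v ->
  exists c : 'I_n -> E, (forall u, W u -> \sum_i u 0 i * c i = 0)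
    /\ \sum_i v 0 i * c i = 1.
Proof.
move=> sW nWv.
have step (r : seq 'I_n) : exists W' : 'rV[E]_n -> Prop,
    [/\ subspace W', forall u, W u -> W' u, ~ W' v &
        forall i, i \in r -> exists c, W' (delta_mx 0 i - c *: v)].
  elim: r => [|i r [W' [sW' WW' nWv' hr]]]; first by exists W; split.
  have [[c hc]|nc] := pselect (exists c, W' (delta_mx 0 i - c *: v)).
    by exists W'; split=> // j /[!inE] /orP[/eqP->|/hr //]; exists c.
  exists (fun u => exists u' t, W' u' /\ u = u' + t *: delta_mx 0 i).
  have incl u : W' u -> exists u' t, W' u' /\ u = u' + t *: delta_mx 0 i.
    by move=> Wu; exists u, 0; rewrite scale0r addr0.
  split.
  - split; first exact: incl (sW'.1).
    move=> a _ _ [u1 [t1 [W1 ->]]] [u2 [t2 [W2 ->]]].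
    exists (a *: u1 + u2), (a * t1 + t2); split; first exact: sW'.2.
    by rewrite scalerDr scalerDl scalerA addrACA.
  - by move=> u /WW' /incl.
  - case=> u [t [Wu ev]].
    have [t0|/divE Ut] := eqVneq t 0.
      by apply: nWv'; rewrite ev t0 scale0r addr0.
    apply: nc; exists t^-1; rewrite ev scalerDr scalerA mulVr // scale1r.
    by rewrite opprD addrCA subrr addr0 -scaleNr; apply: subspaceZ.
  move=> j /[!inE] /orP[/eqP->|/hr[c /incl ?]]; last by exists c.
  exists 0, 0, 1; split; first exact: sW'.1.
  by rewrite scale0r subr0 scale1r add0r.
have [W' [sW' WW' nWv' hr]] := step (enum 'I_n).
have /choice[c hc] (i : 'I_n) : exists c, W' (delta_mx 0 i - c *: v).
  by apply: hr; rewrite mem_enum.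
exists c.
have key (u : 'rV[E]_n) : W' (u - (\sum_i u 0 i * c i) *: v).
  rewrite [X in X - _]row_sum_delta scaler_suml -sumrB.
  have [W0 _] := sW'; elim/big_ind: _ => //.
    by move=> x y; apply: subspaceD.
  by move=> i _; rewrite -scalerA -scalerBr; apply: subspaceZ.
have zero t : W' (t *: v) -> t = 0.
  move=> Wt; apply/eqP/negP => /negP/divE Ut; apply: nWv'.
  by rewrite -[v]scale1r -(mulVr Ut) -scalerA; apply: subspaceZ.
split=> [u Wu|].
  apply: zero; rewrite -[X in W' X]opprK -scaleN1r; apply: subspaceZ => //.
  rewrite -[- _](addKr u); apply: subspaceD => //.
  by rewrite -scaleN1r; apply: subspaceZ => //; apply: WW'.
apply/esym/eqP; rewrite -subr_eq0; apply/eqP/zero.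
by rewrite scalerBl scale1r.
Qed.

Implicit Types h : hform rho.

Lemma hformZl h a u v : h (a *: u) v = a * h u v.
Proof. by have := hlinear (h := h) a u 0 v; rewrite hform0l !addr0. Qed.

Lemma hformDr h u v v' : h u (v + v') = h u v + h u v'.
Proof. by rewrite hherm hformDl invoD -!hherm. Qed.

Lemma hformZr h a u v : h u (a *: v) = h u v * rho a.
Proof. by rewrite hherm hformZl invoM -hherm. Qed.

Lemma hform_suml h n (F : 'I_n -> 'rV[E]_(hdim h)) v :
  h (\sum_i F i) v = \sum_i h (F i) v.
Proof.
by apply: (big_morph (h^~ v)) => [u u'|]; rewrite ?hformDl ?hform0l.
Qed.

(** Nondegeneracy makes the map to the dual injective; by separation its image
    is everything, since a functional on the dual is evaluation at a vector. *)
Lemma hform_rep h (c : 'I_(hdim h) -> E) :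
  exists w, forall u, h u w = \sum_i u 0 i * c i.
Proof.
pose T w : 'rV[E]_(hdim h) := \row_i h w (delta_mx 0 i).
have [[w ew]|nw] := pselect (exists w, T w = \row_i rho (c i)).
  exists w => u; rewrite {1}[u]row_sum_delta hform_suml.
  apply: eq_bigr => i _; rewrite hformZl hherm.
  by have /rowP/(_ i) := ew; rewrite !mxE => ->; rewrite invoK.
have sT : subspace (fun r => exists w, T w = r).
  split; first by exists 0; apply/rowP => i; rewrite !mxE hform0l.
  move=> a _ _ [u <-] [v <-]; exists (a *: u + v).
  by apply/rowP => i; rewrite !mxE hlinear.
have [d [dT d1]] := separating_functional sT nw.
pose v : 'rV[E]_(hdim h) := \row_i rho (d i).
have v0 : v = 0.
  apply: (@hnondeg _ _ h) => w; rewrite hherm.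
  have := dT _ (ex_intro _ w erefl).
  rewrite (eq_bigr (fun i => h w (v 0 i *: delta_mx 0 i))); last first.
    by move=> i _; rewrite hformZr !mxE invoK.
  under eq_bigr do rewrite hherm.
  rewrite -(big_morph (rho : E -> E) (@invoD _ rho) (invo0 rho)) -hform_suml.
  by rewrite -row_sum_delta -hherm => ->; rewrite invo0.
move: d1; rewrite big1 => [/esym/eqP|i _]; first by rewrite oner_eq0.
have /rowP/(_ i) := v0; rewrite !mxE => /(congr1 rho).
by rewrite invoK invo0 => ->; rewrite mulr0.
Qed.

Lemma double_orthogonal h (W : 'rV[E]_(hdim h) -> Prop) v : subspace W ->
  (forall w, (forall u, W u -> h u w = 0) -> h v w = 0) -> W v.
Proof.
move=> sW hv; apply: contrapT => nWv.
have [c [cW cv]] := separating_functional sW nWv.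
have [w hw] := hform_rep (h := h) c.
have /eqP := hv w (fun u Wu => etrans (hw u) (cW u Wu)).
by rewrite hw cv oner_eq0.
Qed.

Definition anisotropic h := forall u, h u u = 0 -> u = 0.

Lemma hform_sym0 h u v : h u v = 0 -> h v u = 0.
Proof. by rewrite hherm => /(congr1 rho); rewrite invoK invo0. Qed.

Lemma metabolic_subspace h (N : 'rV[E]_(hdim h) -> Prop) :
  (forall v, N v <-> (forall u, N u -> h u v = 0)) -> subspace N.
Proof.
move=> hN; split; first by apply/hN => u _; rewrite hform0r.
move=> a u v /hN Nu /hN Nv; apply/hN => w Nw.
by rewrite hformDr hformZr Nu // Nv // mul0r addr0.
Qed.

Lemma metabolic_isometric h h' : isometric h h' -> metabolic h' -> metabolic h.
Proof.
case=> f [[g fg gf] hf] [N hN]; exists (fun v => N (f v)) => v; split.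
  by move=> /hN Nv u Nu; rewrite -hf Nv.
by move=> hv; apply/hN => u Nu; rewrite -[u]gf hf hv // gf.
Qed.

(** Let [N = N^perp] in the metabolic space [h + m], and [M = M^perp] in [m].
    A vector of [N] in [h + M] has an isotropic, hence zero, [h]-component, so
    [h] is orthogonal to the intersection of [N = N^perp] and
    [h + M = M^perp], and lies in [N + M] by double orthogonality.  A vector
    [x] of [h] is then, modulo [M], a vector of [N] in [h + M], so [x = 0]. *)
Lemma anisotropic_witt0 h :
  anisotropic h -> witt_eq h (hzero rho) -> hdim h = 0%N.
Proof.
move=> ah [m [m' [[M hM] mm' iso]]].
have : metabolic (hsum h m).
  apply: metabolic_isometric iso _; apply: metabolic_hsum mm'.
  exact: metabolic_hzero.
case=> N hN; have sN := metabolic_subspace hN.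
have sM := metabolic_subspace hM.
have NM u : N u -> M (rsubmx u) -> lsubmx u = 0.
  move=> Nu Mu; apply: ah; have := (hN u).1 Nu u Nu.
  by rewrite /= /hsum_val ((hM _).1 Mu) // addr0.
have zero (x : 'rV[E]_(hdim h)) : x = 0.
  pose S (u : 'rV[E]_(hdim h + hdim m)) :=
    exists n y, [/\ N n, M y & u = n + row_mx 0 y].
  have sS : subspace S.
    split.
      exists 0, 0; split; [exact: sN.1 | exact: sM.1 |].
      by rewrite row_mx0 addr0.
    move=> a _ _ [n1 [y1 [N1 M1 ->]]] [n2 [y2 [N2 M2 ->]]].
    exists (a *: n1 + n2), (a *: y1 + y2).
    split; [exact: sN.2 | exact: sM.2 |].
    rewrite scalerDr addrACA scale_row_mx add_row_mx scaler0 addr0.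
    by [].
  have [n [y [Nn My exy]]] : S (row_mx x 0).
    apply: (@double_orthogonal (hsum h m)) => // w hw.
    have Nw : N w.
      apply/hN => u Nu; apply: hw; exists u, 0; split=> //; first exact: sM.1.
      by rewrite row_mx0 addr0.
    have Mw : M (rsubmx w).
      apply/hM => u Mu; have := hw (row_mx 0 u).
      rewrite /= /hsum_val row_mxKl row_mxKr hform0l add0r; apply.
      by exists 0, u; split=> //; [exact: sN.1 | rewrite add0r].
    by rewrite /= /hsum_val row_mxKl row_mxKr hform0l addr0 NM // hform0r.
  have en : n = row_mx x (- y).
    rewrite -[n](addrK (row_mx 0 y)) -exy -scaleN1r scale_row_mx add_row_mx.
    by rewrite scaler0 addr0 add0r scaleN1r.
  have := NM n Nn; rewrite en row_mxKl row_mxKr; apply.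
  by rewrite -scaleN1r; apply: subspaceZ.
move: zero; case: (hdim h) => // n /(_ (const_mx 1)) /rowP /(_ 0) /eqP.
by rewrite !mxE oner_eq0.
Qed.

(** * Diagonalization *)

Lemma sym_unitsP s :
  reflect {in s, forall u, rho u = u /\ u \is a GRing.unit}
          (sym_units rho s).
Proof.
apply: (iffP allP) => hs u /hs; first by case/andP=> /eqP.
by case=> /eqP-> ->.
Qed.

Lemma sym_units_cons c s : sym_units rho (c :: s) =
  sym_units rho [:: c] && sym_units rho s.
Proof. by rewrite /= andbT. Qed.

Lemma diag_form_irr s s' (ok : sym_units rho s) (ok' : sym_units rho s') :
  s = s' -> isometric (diag_form ok) (diag_form ok').
Proof.
move=> e; case: s' / e ok' => ok'.
by rewrite (bool_irrelevance ok ok'); apply: isometric_refl.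
Qed.

Lemma diag_cons c s (okc : sym_units rho [:: c]) (oks : sym_units rho s)
    (ok : sym_units rho (c :: s)) :
  isometric (hsum (diag_form okc) (diag_form oks)) (diag_form ok).
Proof.
apply: (@isometric_lin _ _ (hsum (diag_form okc) (diag_form oks))
  (diag_form ok) id id) => //= u v.
rewrite /hsum_val /= /diag_val /= big_ord_recl big_ord1 /=.
congr (_ * _ * rho _ + _); rewrite ?mxE; try by congr (_ _ _); apply: val_inj.
apply: eq_bigr => i _; rewrite !mxE.
by congr (u _ _ * _ * rho (v _ _)); apply: val_inj.
Qed.

Lemma diag_cat s t (oks : sym_units rho s) (okt : sym_units rho t)
    (ok : sym_units rho (s ++ t)) :
  isometric (hsum (diag_form oks) (diag_form okt)) (diag_form ok).
Proof.
elim: s oks ok => [|c s IH] oks ok.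
  apply: isometric_trans (hsumC _ _) _.
  apply: isometric_trans (hsum_isometric (isometric_refl _) _) (hsum0 _).
  apply: (@isometric_lin _ _ (diag_form oks) (hzero rho) id id) => //= u v.
  by rewrite /diag_val big_ord0.
have [okc oks'] : sym_units rho [:: c] /\ sym_units rho s.
  by apply/andP; rewrite -sym_units_cons.
have ok' : sym_units rho (s ++ t).
  have : sym_units rho (c :: s ++ t) by [].
  by rewrite sym_units_cons => /andP[].
apply: isometric_trans (diag_cons okc ok' ok).
apply: isometric_trans (hsum_isometric (isometric_refl _) (IH oks' ok')).
apply: isometric_trans (isometric_sym (hsumA _ _ _)).
apply: hsum_isometric (isometric_refl _).
exact: isometric_sym (diag_cons _ _ _).
Qed.

Lemma sym_units_scale d c : d != 0 -> sym_units rho [:: c] ->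
  sym_units rho [:: d * c * rho d].
Proof.
move=> /divE Ud /=; rewrite !andbT => /andP[/eqP cc Uc].
rewrite !invoM invoK cc mulrA eqxx /= unitrMl ?(invoV rho Ud).2 //.
by rewrite unitrMr.
Qed.

Lemma diag_scale d c (okc : sym_units rho [:: c])
    (ok : sym_units rho [:: d * c * rho d]) : d != 0 ->
  isometric (diag_form ok) (diag_form okc).
Proof.
move=> /divE Ud.
apply: (@isometric_lin _ _ (diag_form ok) (diag_form okc)
  (fun u => \row_i (u 0 i * d)) (fun u => \row_i (u 0 i / d))).
- by move=> a u v; apply/rowP => i; rewrite !mxE mulrDl mulrA.
- by move=> u; apply/rowP => i; rewrite !mxE mulrK.
- by move=> u; apply/rowP => i; rewrite !mxE mulrVK.
by move=> u v; rewrite /= /diag_val !big_ord1 /= !mxE invoM !mulrA.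
Qed.

Hypothesis two_neq0 : (2%:R : E) != 0.

(** Polarization: if [h u v = 1] and [h] vanishes on the diagonal, then
    [h (u + v) (u + v) = 2]. *)
Lemma exists_anisotropic_vector h :
  hdim h != 0%N -> exists u, h u u != 0.
Proof.
move=> h0; apply: contrapT => nu.
have hu u : h u u = 0.
  by apply/eqP; apply: contrapT => ?; apply: nu; exists u; apply/negP.
have [u /eqP u0] : exists u : 'rV[E]_(hdim h), u != 0.
  move: h0; case: (hdim h) => // n _; exists (const_mx 1).
  by apply/eqP => /rowP /(_ 0) /eqP; rewrite !mxE oner_eq0.
have [v /eqP uv] : exists v, h u v <> 0.
  apply: contrapT => nv; apply/u0/(@hnondeg _ _ h) => v.
  by apply: contrapT => ?; apply: nv; exists v.
have := hu ((h u v)^-1 *: u + v).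
rewrite hformDl !hformDr !hu addr0 add0r [h v _]hherm hformZl mulVr ?divE //.
by rewrite invo1; apply/eqP; rewrite -mulr2n.
Qed.

(** A coordinate [i] in which [u] does not vanish identifies the orthogonal of
    [u] with the vectors whose [i]-th coordinate is 0. *)
Lemma split_anisotropic_vector n h (u : 'rV[E]_(hdim h)) :
  hdim h = n.+1 -> h u u != 0 ->
  exists c (ok : sym_units rho [:: c]) h', hdim h' = n
    /\ isometric h (hsum (diag_form ok) h').
Proof.
case: h u => dh hv hl hh hn u /= edh; case: _ / (esym edh) hv hl hh hn u.
move=> hv hl hh hn /= u; pose h := HForm hl hh hn; rewrite -[hv u u]/(h u u).
move=> huu; set c := h u u in huu.
have Uc := divE huu.
have okc : sym_units rho [:: c] by rewrite /= -hherm eqxx Uc.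
have [i ui] : exists i, u 0 i != 0.
  apply: contrapT => nu; case/eqP: huu; rewrite /c.
  suff -> : u = 0 by exact: hform0l.
  apply/rowP => i; rewrite mxE; apply/eqP; apply: contrapT => ?.
  by apply: nu; exists i; apply/negP.
have Ui := divE ui.
(* [g] projects padded vectors onto the orthogonal of [u]; [F] and [G] are the
   inverse isomorphisms between [E u + E^n] and [E^(n+1)]. *)
pose pad (x : 'rV[E]_n) : 'rV[E]_n.+1 :=
  \row_j oapp (fun k => x 0 k) 0 (unlift i j).
pose g x := pad x - (h (pad x) u / c) *: u.
have padl : linear pad.
  move=> a x y; apply/rowP => j; rewrite !mxE.
  by case: (unlift i j) => [k|] /=; rewrite ?mxE ?mulr0 ?addr0.
have gl : linear g.
  move=> a x y; rewrite /g padl hlinear mulrDl scalerDl opprD scalerBr scalerA.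
  by rewrite addrACA mulrA.
have gu x : h (g x) u = 0.
  by rewrite /g hformDl hformNl hformZl mulrVK // subrr.
have ug x : h u (g x) = 0 by apply: hform_sym0.
pose F (w : 'rV[E]_(1 + n)) : 'rV[E]_n.+1 := lsubmx w 0 0 *: u + g (rsubmx w).
pose G (v : 'rV[E]_n.+1) : 'rV[E]_(1 + n) :=
  row_mx (const_mx (h v u / c))
         (\row_k (v - (v 0 i / u 0 i) *: u) 0 (lift i k)).
have padi x : pad x 0 i = 0 by rewrite mxE unlift_none.
have padk x k : pad x 0 (lift i k) = x 0 k by rewrite mxE liftK.
have FK : cancel F G.
  move=> w; rewrite -[RHS]hsubmxK /G; congr row_mx.
    apply/rowP => j; rewrite !ord1 [LHS]mxE /F hformDl hformZl gu addr0.
    by rewrite mulrK.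
  rewrite /F; set t := lsubmx w 0 0; set x := rsubmx w.
  apply/rowP => k; rewrite /g; set p := _ / c.
  have ei : (t *: u + (pad x - p *: u)) 0 i = (t - p) * u 0 i.
    by rewrite !mxE unlift_none /= add0r mulrBl.
  rewrite mxE [in LHS]mxE ei mulrK // !mxE liftK /= mulrBl.
  by rewrite opprB addrA -(addrA (t * _)) subrK addrAC subrr add0r mxE.
have GK : cancel G F.
  move=> v; rewrite /F /G row_mxKl row_mxKr [const_mx _ _ _]mxE.
  set x := (X in g X); set t := v 0 i / u 0 i.
  have ex : pad x = v - t *: u.
    apply/rowP => j; have [k ->|->] := unliftP i j; first by rewrite padk !mxE.
    by rewrite padi !mxE mulrVK // subrr.
  rewrite /g ex hformDl hformNl hformZl mulrBl mulrK // scalerBl.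
  by rewrite opprB -(addrA v) addKr addrCA subrr addr0.
(* From here on only linearity of [g] and orthogonality to [u] matter. *)
clearbody g.
have gh_linear a x x' y : h (g (a *: x + x')) (g y) =
    a * h (g x) (g y) + h (g x') (g y) by rewrite gl hlinear.
have gh_herm x y : h (g x) (g y) = rho (h (g y) (g x)) by rewrite -hherm.
have gh_nondeg x : (forall y, h (g x) (g y) = 0) -> x = 0.
  move=> hx; have gx : g x = 0.
    apply: (@hnondeg _ _ h) => v; rewrite -[v]GK /F hformDr hformZr gu mul0r.
    by rewrite hx addr0.
  have g0 : g 0 = 0 by have := gl (-1) 0 0; rewrite !scaleN1r oppr0 addr0 addNr.
  have e : row_mx 0 x = 0 :> 'rV_(1 + n).
    by apply: (can_inj FK); rewrite /F row_mxKl row_mxKr !linear0 gx g0.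
  by rewrite -(row_mxKr (0 : 'rV[E]_1) x) e linear0.
pose h' := HForm gh_linear gh_herm gh_nondeg.
exists c, okc, h'; split=> //; apply: isometric_sym.
apply: (@isometric_lin _ _ (hsum (diag_form okc) h') h F G) => //.
  move=> a w w'; rewrite /F !linearP /= gl.
  have -> (M N : 'rV[E]_1) : (a *: M + N) 0 0 = a * M 0 0 + N 0 0.
    by rewrite !mxE.
  rewrite [in LHS]scalerDl [in RHS]scalerDr scalerA.
  by rewrite addrACA.
move=> w w'; rewrite -[LHS]/(h (F w) (F w')).
rewrite -[RHS]/(@diag_val E rho [:: c] (lsubmx w) (lsubmx w')
  + h (g (rsubmx w)) (g (rsubmx w'))) /diag_val big_ord1 /F.
rewrite hformDl !hformDr !hformZl !hformZr gu ug.
by rewrite !mulr0 mul0r addr0 add0r mulrA.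
Qed.

Lemma diagonalization h : exists s (ok : sym_units rho s),
  isometric h (diag_form ok).
Proof.
move en: (hdim h) => n; elim: n h en => [|n IH] h eh.
  have ok : sym_units rho [::] by [].
  exists [::], ok; case: h eh => dh hv hl hh hn /= e.
  case: _ / (esym e) hv hl hh hn => hv hl hh hn.
  apply: (@isometric_lin _ _ (HForm hl hh hn) (diag_form ok) id id) => //= u v.
  rewrite /diag_val big_ord0 (thinmx0 u).
  exact/esym/(hform0l (h := HForm hl hh hn)).
have [u hu] := exists_anisotropic_vector (h := h) ltac:(by rewrite eh).
have [c [okc [h' [eh' iso]]]] := split_anisotropic_vector eh hu.
have [s [oks iso']] := IH h' eh'.
have ok : sym_units rho (c :: s) by rewrite sym_units_cons okc.
exists (c :: s), ok; apply: isometric_trans iso _.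
apply: isometric_trans (hsum_isometric (isometric_refl _) iso') _.
exact: diag_cons.
Qed.

(** * Presentation of the Witt group *)

Local Notation W := (witt rho).

(** Extended by 0 to all of [E], so that the class of a diagonal form is the
    sum of the values of a total function over its entries. *)
Definition wclass1 (c : E) : W :=
  if @idP (sym_units rho [:: c]) is ReflectT ok then wclass (diag_form ok)
  else 0.

Lemma wclass1E c (ok : sym_units rho [:: c]) :
  wclass1 c = wclass (diag_form ok).
Proof.
rewrite /wclass1; case: {-}_ / idP => [ok'|/negP/negP]; last by rewrite ok.
exact/wclassP/isometric_witt/diag_form_irr.
Qed.

Lemma wclass_diag s (ok : sym_units rho s) :
  wclass (diag_form ok) = \sum_(c <- s) wclass1 c.
Proof.
elim: s ok => [|c s IH] ok.
  rewrite big_nil; apply/wclassP/isometric_witt.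
  apply: (@isometric_lin _ _ (diag_form ok) (hzero rho) id id) => //= u v.
  by rewrite /diag_val big_ord0.
have [okc oks] : sym_units rho [:: c] /\ sym_units rho s.
  by apply/andP; rewrite -sym_units_cons.
rewrite big_cons (wclass1E okc) -IH -wclassD.
exact/esym/wclassP/isometric_witt/diag_cons.
Qed.

Lemma witt_diag (w : W) : exists2 s, sym_units rho s
  & w = \sum_(c <- s) wclass1 c.
Proof.
rewrite -[w]wclass_repr; have [s [ok iso]] := diagonalization (repr w).
by exists s => //; rewrite -(wclass_diag ok); apply/wclassP/isometric_witt.
Qed.

(** The relations between rank 1 forms: rescaling, the two diagonalizations
    <a, b> and <a + b, a + a b^-1 a> of a binary form, and hyperbolicity of
    <a, -a>. *)
Record witt_relations (G : zmodType) (f : E -> G) : Prop := WittRelations {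
  wrel_scale : forall d c, d != 0 -> sym_units rho [:: c] ->
    f (d * c * rho d) = f c;
  wrel_add : forall a b, sym_units rho [:: a; b] -> a + b != 0 ->
    f a + f b = f (a + b) + f (a + a / b * a);
  wrel_opp : forall a, sym_units rho [:: a] -> f a + f (- a) = 0
}.

Lemma sym_units1 c : sym_units rho [:: c] = (rho c == c) && (c != 0).
Proof.
rewrite /= andbT; congr andb; apply/idP/idP => [Uc|/divE //].
by apply/eqP => c0; rewrite c0 unitr0 in Uc.
Qed.

Lemma mul_neq0 (a b : E) : a != 0 -> b != 0 -> a * b != 0.
Proof.
move=> /divE Ua; apply: contraNneq => e.
by apply/eqP/(mulrI Ua); rewrite e mulr0.
Qed.

Lemma inv_neq0 (a : E) : a != 0 -> a^-1 != 0.
Proof. by rewrite invr_eq0. Qed.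

Lemma sym_units_add a b : sym_units rho [:: a; b] -> a + b != 0 ->
  sym_units rho [:: a + b] /\ sym_units rho [:: a + a / b * a].
Proof.
rewrite sym_units_cons !sym_units1.
move=> /andP[/andP[/eqP ra a0] /andP[/eqP rb b0]].
move=> ab0; have Ub := divE b0.
rewrite !invoD !invoM (invoV rho Ub).1 ra rb mulrA eqxx ab0 eqxx /=.
split=> //; suff -> : a + a / b * a = a / b * (a + b).
  by do ?apply: mul_neq0 => //; apply: inv_neq0.
by rewrite mulrDr mulrVK // addrC.
Qed.

(** The basis used is [(1, 1)] and [(1, - a / b)], which is orthogonal for the
    form <a, b>. *)
Lemma diag_add a b (ok : sym_units rho [:: a; b])
    (ok' : sym_units rho [:: a + b; a + a / b * a]) :
  a + b != 0 -> isometric (diag_form ok') (diag_form ok).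
Proof.
move=> ab0; have := ok.
rewrite sym_units_cons !sym_units1.
move=> /andP[/andP[/eqP ra a0] /andP[/eqP rb b0]].
have Ua := divE a0; have Ub := divE b0; have Uab := divE ab0.
have Ue : 1 + a / b \is a GRing.unit.
  have -> : 1 + a / b = (a + b) / b by rewrite mulrDl mulrV // addrC.
  by apply/divE/mul_neq0 => //; apply: inv_neq0.
pose mk (p q : E) : 'rV[E]_2 := \row_i (if i == 0 then p else q).
have mk_eta (u : 'rV[E]_2) : mk (u 0 0) (u 0 1) = u.
  by apply/rowP => i; rewrite mxE; case: eqP => [->//|/eqP i0]; congr (u _ _);
     apply/val_inj; case: i i0 => -[|[|]].
pose F (u : 'rV[E]_2) := mk (u 0 0 + u 0 1) (u 0 0 - u 0 1 * (a / b)).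
pose y (u : 'rV[E]_2) := (u 0 0 - u 0 1) / (1 + a / b).
pose G (u : 'rV[E]_2) := mk (u 0 0 - y u) (y u).
have FK : cancel F G.
  move=> u; rewrite /G; suff -> : y (F u) = u 0 1.
    by rewrite !mxE /= addrK mk_eta.
  rewrite /y !mxE /= opprB addrC addrA subrK.
  have -> : u 0 1 * (a / b) + u 0 1 = u 0 1 * (1 + a / b).
    by rewrite mulrDr mulr1 addrC.
  by rewrite mulrK.
have GK : cancel G F.
  move=> u; rewrite /F !mxE /= subrK -addrA -opprD -{1}[y u]mulr1 -mulrDr.
  by rewrite mulrVK // opprB addrC subrK mk_eta.
apply: (@isometric_lin _ _ (diag_form ok') (diag_form ok) F G) => //.
  move=> t u v; apply/rowP => i; rewrite !mxE; case: eqP => _.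
    by rewrite mulrDr addrACA.
  by rewrite mulrBr mulrDl opprD addrACA !mulrA.
move=> u v; rewrite /= /diag_val /= !big_ord_recl !big_ord0 /= !addr0 !mxE /=.
have e01 : lift ord0 ord0 = 1 :> 'I_2 by apply: val_inj.
rewrite e01; set p := u 0 0; set q := u 0 1; set r := v 0 0; set s := v 0 1.
rewrite !(invoD, invoN, invoM) (invoV rho Ub).1 ra rb.
have ebb z : b * (b^-1 * z) = z by rewrite mulVKr.
have ebb' z : b^-1 * (b * z) = z by rewrite mulKr.
rewrite !(mulrDl, mulrDr, mulrN, mulNr, mulrA) -!mulrA !(ebb, ebb') !mulrA.
rewrite opprK addrACA; congr (_ + _); first by rewrite addrACA subrr addr0.
by rewrite addrACA subrr add0r.
Qed.

Lemma sym_units_mem s c : sym_units rho s -> c \in s -> sym_units rho [:: c].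
Proof. by move=> /sym_unitsP hs /hs[rc Uc]; rewrite /= rc eqxx Uc. Qed.

#[local] Arguments sym_units E rho s : simpl never.

Lemma wclass1_relations : witt_relations wclass1.
Proof.
split=> [d c d0 okc|a b ok ab0|a ok].
- rewrite (wclass1E okc) (wclass1E (sym_units_scale d0 okc)).
  exact/wclassP/isometric_witt/diag_scale.
- have [ok1 ok2] := sym_units_add ok ab0.
  have ok' : sym_units rho [:: a + b; a + a / b * a].
    by rewrite sym_units_cons ok1.
  have := wclass_diag ok'; rewrite !big_cons big_nil addr0 => <-.
  have := wclass_diag ok; rewrite !big_cons big_nil addr0 => <-.
  exact/esym/wclassP/isometric_witt/diag_add.
have okN : sym_units rho [:: - a].
  by move: ok; rewrite !sym_units1 invoN eqr_opp oppr_eq0.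
rewrite (wclass1E ok) (wclass1E okN) addrC -wclassD.
apply: (etrans (y := wclass (hsum (hopp (diag_form ok)) (diag_form ok)))).
  apply/wclassP/isometric_witt/hsum_isometric; last exact: isometric_refl.
  apply: (@isometric_lin _ _ (diag_form okN) (hopp (diag_form ok)) id id) => //.
  by move=> u v; rewrite /= /diag_val !big_ord1 /= mulrN mulNr.
exact/wclassP/metabolic_witt/metabolic_hopp.
Qed.

(** Equality in the abelian group presented by [witt_relations], expressed
    through all its quotients. *)
Definition same_class (s s' : seq E) : Prop :=
  forall (G : zmodType) (f : E -> G), witt_relations f ->
    \sum_(c <- s) f c = \sum_(c <- s') f c.

(** Gram-Schmidt along partial sums: while the partial sum [t] is
    nonzero, it is the first entry of an equivalent diagonal form, and a partial
    sum that vanishes without being trivial exhibits a subform <a, -a>, which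
    the third relation deletes. *)
Lemma split_value s (x : nat -> E) : sym_units rho s ->
  let t := \sum_(i < size s) x i * s`_i * rho (x i) in
  [\/ forall i, (i < size s)%N -> x i = 0,
      t != 0 /\ exists s', [/\ sym_units rho (t :: s'), size s = (size s').+1
                             & same_class s (t :: s')]
    | exists s', [/\ sym_units rho s', (size s' < size s)%N
                   & same_class s s']].
Proof.
elim: s x => [|c s IH] x ok; first by constructor 1.
have [okc oks] : sym_units rho [:: c] /\ sym_units rho s.
  by apply/andP; rewrite -sym_units_cons.
rewrite /= big_ord_recl /=.
set t := \sum_(i < size s) _.
have := IH (fun i => x i.+1) oks; rewrite /= -/t.
case=> [xs0|[t0 [s' [oks' ss' eqs]]]|].
- have -> : t = 0.
    by rewrite /t big1 // => i _; rewrite xs0 // !mul0r.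
  rewrite addr0; have [x0|x0] := eqVneq (x 0%N) 0.
    by constructor 1 => -[|i] //; apply: xs0.
  have okt := sym_units_scale x0 okc.
  constructor 2; split; first by move: okt; rewrite sym_units1 => /andP[].
  exists s; split=> //; first by rewrite sym_units_cons okt.
  by move=> G f hf; rewrite !big_cons (wrel_scale hf).
- have [okt oks1] : sym_units rho [:: t] /\ sym_units rho s'.
    by apply/andP; rewrite -sym_units_cons.
  have [x0|x0] := eqVneq (x 0%N) 0.
    rewrite x0 !mul0r add0r; constructor 2; split=> //.
    exists (c :: s'); split; last 2 first.
    + by rewrite /= ss'.
    + by move=> G f hf; rewrite !big_cons (eqs _ _ hf) big_cons addrCA.
    by rewrite sym_units_cons okt sym_units_cons okc.
  have oka := sym_units_scale x0 okc.
  set a := x 0%N * c * rho (x 0%N) in oka *.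
  have okat : sym_units rho [:: a; t] by rewrite sym_units_cons oka.
  have ca (G : zmodType) (f : E -> G) : witt_relations f -> f c = f a.
    by move=> hf; rewrite (wrel_scale hf).
  have [at0|at0] := eqVneq (a + t) 0.
    constructor 3; exists s'; split=> //; first by rewrite ss' ltnS ltnW.
    move=> G f hf; rewrite big_cons (eqs _ _ hf) big_cons (ca _ _ hf) addrA.
    have -> : t = - a by apply/eqP; rewrite -addr_eq0 addrC at0.
    by rewrite (wrel_opp hf) // add0r.
  have [ok1 ok2] := sym_units_add okat at0.
  constructor 2; split=> //; exists (a + a / t * a :: s'); split.
  + by rewrite sym_units_cons ok1 sym_units_cons ok2.
  + by rewrite /= ss'.
  move=> G f hf; rewrite !big_cons (eqs _ _ hf) big_cons (ca _ _ hf).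
  by rewrite !addrA (wrel_add hf).
case=> s' [oks' ss' eqs]; constructor 3; exists (c :: s'); split=> //.
  by rewrite sym_units_cons okc.
by move=> G f hf; rewrite !big_cons (eqs _ _ hf).
Qed.

Lemma anisotropic_representative s : sym_units rho s ->
  exists s0 (ok : sym_units rho s0),
    anisotropic (diag_form ok) /\ same_class s s0.
Proof.
have [n] := ubnP (size s); elim: n s => // n IH s sn ok.
have [an|] := pselect (anisotropic (diag_form ok)); first by exists s, ok.
move=> /existsNP[u] /not_implyP[hu u0].
pose x i := oapp (fun j : 'I_(size s) => u 0 j) 0 (insub i).
have xE (i : 'I_(size s)) : x i = u 0 i by rewrite /x valK.
have := split_value x ok.
have -> : \sum_(i < size s) x i * s`_i * rho (x i) = 0.
  by apply: etrans hu; rewrite /= /diag_val; apply: eq_bigr => i _; rewrite xE.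
case=> [x0|[/eqP] //|[s' [ok' ss' e]]].
  by case: u0; apply/rowP => i; rewrite mxE -xE x0.
have [s0 [ok0 [an0 e0]]] := IH s' (leq_trans ss' sn) ok'.
exists s0, ok0; split=> // G f hf.
by rewrite (e _ _ hf) (e0 _ _ hf).
Qed.

Lemma sym_units_oppcat s s' : sym_units rho s -> sym_units rho s' ->
  sym_units rho (s ++ map -%R s').
Proof.
rewrite /sym_units all_cat => -> /allP ok'.
apply/allP => x /mapP[c /ok' /andP[/eqP rc Uc] ->].
by rewrite invoN rc eqxx unitrN.
Qed.

(** The difference of the two lists is equivalent to an anisotropic list of
    trivial class, which is empty. *)
Lemma witt_presentation (G : zmodType) (f : E -> G) s s' :
  witt_relations f -> sym_units rho s -> sym_units rho s' ->
  \sum_(c <- s) wclass1 c = \sum_(c <- s') wclass1 c ->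
  \sum_(c <- s) f c = \sum_(c <- s') f c.
Proof.
move=> hf oks oks' e.
have neg (G' : zmodType) (g : E -> G') : witt_relations g ->
    \sum_(c <- s ++ map -%R s') g c = \sum_(c <- s) g c - \sum_(c <- s') g c.
  move=> hg; rewrite big_cat big_map -sumrN; congr (_ + _).
  apply: eq_big_seq => c cs'; apply/eqP; rewrite -addr_eq0 addrC.
  rewrite (wrel_opp hg) //; exact: sym_units_mem oks' cs'.
have [s0 [ok0 [an0 e0]]] :=
  anisotropic_representative (sym_units_oppcat oks oks').
have : \sum_(c <- s0) wclass1 c = 0.
  by rewrite -(e0 _ _ wclass1_relations) (neg _ _ wclass1_relations) e subrr.
rewrite -(wclass_diag ok0) => /wclassP/(anisotropic_witt0 an0) /= /size0nil s00.
apply/eqP; rewrite -subr_eq0 -(neg _ _ hf) (e0 _ _ hf) s00.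
by rewrite big_nil.
Qed.

(** The Witt group is the abelian group generated by the rank 1 forms subject
    to [witt_relations]. *)
Lemma witt_lift (G : zmodType) (f : E -> G) : witt_relations f ->
  exists phi : {additive W -> G}, forall s, sym_units rho s ->
    phi (\sum_(c <- s) wclass1 c) = \sum_(c <- s) f c.
Proof.
move=> hf; have /choice[l hl] (w : W) : exists s, sym_units rho s /\
    w = \sum_(c <- s) wclass1 c by have [s] := witt_diag w; exists s.
(* [l w] is a chosen diagonalization of [w]. *)
pose phi w := \sum_(c <- l w) f c.
have phiE s : sym_units rho s ->
    phi (\sum_(c <- s) wclass1 c) = \sum_(c <- s) f c.
  move=> ok; have [okl el] := hl (\sum_(c <- s) wclass1 c).
  exact: witt_presentation hf okl ok (esym el).
have phiB : zmod_morphism phi.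
  move=> v w; have [okv ev] := hl v; have [okw ew] := hl w.
  have e : v - w = \sum_(c <- l v ++ map -%R (l w)) wclass1 c.
    rewrite {1}ev {1}ew big_cat big_map -sumrN; congr (_ + _).
    apply: eq_big_seq => c cw; apply/esym/eqP; rewrite -addr_eq0 addrC.
    by rewrite (wrel_opp wclass1_relations) // (sym_units_mem okw).
  rewrite e phiE ?sym_units_oppcat // big_cat big_map /= -sumrN; congr (_ + _).
  apply: eq_big_seq => c cw; apply/eqP; rewrite -addr_eq0 addrC.
  by rewrite (wrel_opp hf) // (sym_units_mem okw).
pose F := GRing.isZmodMorphism.Build _ _ phi phiB.
pose phia : {additive W -> G} := HB.pack phi F.
by exists phia.
Qed.

End DivisionRing.

(** * Discrete valuations and square roots of 1-units *)

Section ResidueMap.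
Variables (A : nzRingType) (V : numDomainType) (v : A -> V).
Variables (B : nzRingType) (r : A -> B).
Hypothesis hr : residue_map v r.

Lemma val_ring0 : 0 \in val_ring v.
Proof. by rewrite unfold_in /= eqxx. Qed.

Lemma res0 : r 0 = 0.
Proof. by apply: (addrI (r 0)); rewrite -(resD hr) ?val_ring0 // !addr0. Qed.

Lemma resN c : c \in val_ring v -> - c \in val_ring v -> r (- c) = - r c.
Proof.
by move=> hc hN; apply: (addrI (r c)); rewrite -(resD hr) // !subrr res0.
Qed.

End ResidueMap.

Section Valuation.
Variables (K : fieldType) (nu : K -> int).
Hypothesis nu_val : normalized_valuation nu.
Local Notation "c \ge n" := (val_ge nu n c) (at level 70).

Lemma nu1 : nu 1 = 0.
Proof.
by apply: (addrI (nu 1)); rewrite -(Defs.valM nu_val) ?oner_eq0 // mulr1 addr0.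
Qed.

Lemma nuN c : c != 0 -> nu (- c) = nu c.
Proof.
move=> c0; rewrite -mulN1r (Defs.valM nu_val) ?oppr_eq0 ?oner_eq0 //.
have : nu (-1) + nu (-1) = 0.
  by rewrite -(Defs.valM nu_val) ?oppr_eq0 ?oner_eq0 // mulrNN mulr1 nu1.
lia.
Qed.

Lemma nuV c : c != 0 -> nu c^-1 = - nu c.
Proof.
move=> c0; apply: (addrI (nu c)).
by rewrite -(Defs.valM nu_val) ?invr_eq0 // mulfV // nu1 subrr.
Qed.

Lemma val_geE n c : c != 0 -> (c \ge n) = (n <= nu c).
Proof. by rewrite /val_ge => /negbTE ->. Qed.

Lemma val_ge0 n : 0 \ge n. Proof. by rewrite /val_ge eqxx. Qed.

Lemma val_ge1 : 1 \ge 0.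
Proof. by rewrite /val_ge nu1 lexx orbT. Qed.

Lemma val_geW m n c : m <= n -> c \ge n -> c \ge m.
Proof.
by rewrite /val_ge => mn /orP[->//|cn]; rewrite (le_trans mn) // orbT.
Qed.

Lemma val_geN n c : c \ge n -> - c \ge n.
Proof.
have [->|c0] := eqVneq c 0; first by rewrite oppr0.
by rewrite !val_geE ?oppr_eq0 // nuN.
Qed.

Lemma val_geD n c d : c \ge n -> d \ge n -> c + d \ge n.
Proof.
have [->|c0] := eqVneq c 0; first by rewrite add0r.
have [->|d0] := eqVneq d 0; first by rewrite addr0.
have [->|cd0] := eqVneq (c + d) 0; first by rewrite val_ge0.
rewrite !val_geE // => hc hd; apply: le_trans (Defs.valD nu_val c0 d0 cd0).
by rewrite le_min hc.
Qed.

Lemma val_geB n c d : c \ge n -> d \ge n -> c - d \ge n.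
Proof. by move=> hc /val_geN; apply: val_geD. Qed.

Lemma val_geM m n c d : c \ge m -> d \ge n -> c * d \ge m + n.
Proof.
have [->|c0] := eqVneq c 0; first by rewrite mul0r !val_ge0.
have [->|d0] := eqVneq d 0; first by rewrite mulr0 !val_ge0.
by rewrite !val_geE ?mulf_neq0 // (Defs.valM nu_val) // => hc hd; lia.
Qed.

Lemma val_geMl n c d : c \ge 0 -> d \ge n -> c * d \ge n.
Proof. by move=> hc hd; have := val_geM hc hd; rewrite add0r. Qed.

Lemma val_geMr n c d : c \ge n -> d \ge 0 -> c * d \ge n.
Proof. by move=> hc hd; rewrite mulrC val_geMl. Qed.

Lemma val_ge_eq0 c : (forall n : nat, c \ge n%:Z) -> c = 0.
Proof.
move=> hc; apply/eqP/negPn/negP => c0.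
by have := hc (`|nu c|.+1)%N; rewrite val_geE //; lia.
Qed.

(** Terms of different values cannot cancel, not even partially. *)
Lemma val_ge_split n c d : c != 0 -> d != 0 -> nu c != nu d ->
  c + d \ge n -> n <= nu c /\ n <= nu d.
Proof.
move=> c0 d0 ncd hcd.
have hc k : k <= n -> k <= nu d -> k <= nu c.
  move=> kn kd; rewrite -val_geE // -[c](addrK d); apply: val_geB.
    exact: val_geW hcd.
  by rewrite val_geE.
have hd k : k <= n -> k <= nu c -> k <= nu d.
  move=> kn kc; rewrite -val_geE // -[d](addKr c) addrC.
  apply: val_geB; last by rewrite val_geE.
  exact: val_geW hcd.
have := hc (Num.min n (nu d)); have := hd (Num.min n (nu c)); lia.
Qed.

Lemma val_ringE c : (c \in val_ring nu) = (c \ge 0).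
Proof. by []. Qed.

Lemma val_idealE c : (c \in val_ideal nu) = (c \ge 1).
Proof. by []. Qed.

Section Residue.
Variables (k : fieldType) (rK : K -> k).
Hypothesis rK_res : residue_map nu rK.
Hypothesis char_k : (2%:R : k) != 0.

Lemma res_unit c : c \ge 0 -> (rK c != 0) = (c != 0) && (nu c == 0).
Proof.
move=> hc; rewrite (res_ker rK_res) // val_idealE /val_ge negb_or.
have [//|c0] := eqVneq c 0.
by move: hc; rewrite val_geE //= => hc; apply/idP/idP; lia.
Qed.

Lemma nu_two : (2%:R : K) != 0 /\ nu 2%:R = 0.
Proof.
have h1 := val_ge1; have e : rK 2%:R = 2%:R.
  by rewrite [2%:R]mulr2n (resD rK_res) // (res1 rK_res).
have := char_k; rewrite -e res_unit; last exact: val_geD.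
by case/andP=> -> /eqP.
Qed.

Lemma val_ge_half n c : c \ge n -> c / 2%:R \ge n.
Proof.
move=> hc; apply: val_geMr => //; have [t0 t] := nu_two.
by rewrite val_geE ?invr_eq0 // nuV // t.
Qed.

Hypothesis nu_complete : complete_valuation nu.

(** With [e = 1 + x], the equation reads [x = (c - x^2) / 2], whose right hand
    side contracts the maximal ideal. *)
Lemma hensel_sqrt c : c \ge 1 -> exists2 e, e - 1 \ge 1 & e ^+ 2 = 1 + c.
Proof.
move=> hc; have [t0 _] := nu_two; pose F x := (c - x ^+ 2) / 2%:R.
have F1 x : x \ge 1 -> F x \ge 1.
  move=> hx; apply/val_ge_half/val_geB => //.
  by apply: val_geW (val_geM hx hx).
have FB n x y : x \ge 1 -> y \ge 1 -> x - y \ge n -> F x - F y \ge n + 1.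
  move=> hx hy hxy; have -> : F x - F y = - ((x - y) * (x + y) / 2%:R).
    by rewrite /F; field.
  by apply/val_geN/val_ge_half/val_geM => //; apply: val_geD.
pose s n := iter n F 0.
have s1 n : s n \ge 1 by elim: n => [|n IH]; [exact: val_ge0 | exact: F1].
have sS n : s n.+1 - s n \ge n.+1%:Z.
  elim: n => [|n IH]; first by rewrite subr0; apply: F1; exact: val_ge0.
  by have := FB _ _ _ (s1 n.+1) (s1 n) IH; apply: val_geW; lia.
have sD n m : s (n + m)%N - s n \ge n%:Z.
  elim: m => [|m IH]; first by rewrite addn0 subrr val_ge0.
  rewrite addnS -[X in X - _](subrK (s (n + m)%N)) -addrA.
  apply: val_geD IH; apply: val_geW (sS _); lia.
have [l hl] : exists l, forall n : int, exists N, forall i, (N <= i)%N ->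
    s i - l \ge n.
  apply: nu_complete => n; exists `|n|%N => i j hi hj.
  rewrite -[s i](subrK (s `|n|%N)) -addrA; apply: val_geD.
    by rewrite -(subnKC hi); apply: val_geW (sD _ _); lia.
  rewrite -opprB; apply: val_geN.
  by rewrite -(subnKC hj); apply: val_geW (sD _ _); lia.
have l1 : l \ge 1.
  have [N /(_ N (leqnn N)) hN] := hl 1.
  by rewrite -[l](subKr (s N)); apply: val_geB.
have fix_l : l = F l.
  apply/eqP; rewrite -subr_eq0; apply/eqP/val_ge_eq0 => n.
  have [N hN] := hl n%:Z.
  have -> : l - F l = (F (s N) - F l) - (s N.+1 - l) by rewrite /s /=; ring.
  apply: val_geB; last by apply: hN.
  by apply: val_geW (FB n%:Z _ _ (s1 N) l1 (hN N _)) => //; lia.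
exists (1 + l); first by rewrite addrC addKr.
have -> : (1 + l) ^+ 2 = 1 + 2%:R * l + l ^+ 2 by ring.
by rewrite [X in 2%:R * X]fix_l /F; field.
Qed.

End Residue.
End Valuation.

(** * Lifting Witt classes from a residue ring *)

Section Lifting.
Variables (E F : unitRingType) (sigma : involution E) (rho : involution F).
Hypothesis divE : forall d : E, d != 0 -> d \is a GRing.unit.
Hypothesis divF : forall d : F, d != 0 -> d \is a GRing.unit.
Hypothesis twoF : (2%:R : F) != 0.
Variables (P : E -> Prop) (r : E -> F).
Hypothesis P_sym : forall u, P u -> sym_units sigma [:: u].
Hypothesis P_lift : forall c, sym_units rho [:: c] -> exists2 u, P u & r u = c.
Hypothesis P_eq : forall u u', P u -> P u' -> r u = r u' ->
  wclass1 sigma u = wclass1 sigma u'.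
Hypothesis P_scale : forall d u, d != 0 -> P u -> exists e,
  [/\ e != 0, P (e * u * sigma e) & r (e * u * sigma e) = d * r u * rho d].
Hypothesis P_add : forall u u', P u -> P u' -> r u + r u' != 0 ->
  [/\ P (u + u'), r (u + u') = r u + r u', P (u + u / u' * u)
    & r (u + u / u' * u) = r u + r u / r u' * r u].
Hypothesis P_opp : forall u, P u -> P (- u) /\ r (- u) = - r u.

(** Here [P] singles out the admissible lifts and [r] takes their residue.  The
    class of a lift is a function of the residue, and it inherits the three
    relations from those satisfied by the lifts. *)
Lemma witt_lift_residue : exists phi : {additive witt rho -> witt sigma},
  forall us, {in us, forall u, P u} -> sym_units rho (map r us) ->
  phi (\sum_(c <- map r us) wclass1 rho c) = \sum_(u <- us) wclass1 sigma u.
Proof.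
have /choice[f hf] c :
    exists w, forall u, P u -> r u = c -> wclass1 sigma u = w.
  have [[u0 [P0 r0]]|nu] := pselect (exists u, P u /\ r u = c).
    by exists (wclass1 sigma u0) => u Pu ru; apply: P_eq => //; rewrite ru.
  by exists 0 => u Pu ru; case: nu; exists u.
have fE u : P u -> f (r u) = wclass1 sigma u by move=> Pu; rewrite (hf (r u)).
have relW := wclass1_relations sigma divE.
have relf : witt_relations rho f.
  split=> [d c d0 okc|c c' ok cc0|c ok].
  - have [u Pu ru] := P_lift okc.
    have [e [e0 Pe re]] := P_scale d0 Pu.
    by rewrite -ru -re !fE // (wrel_scale relW) // P_sym.
  - have [okc okc'] : sym_units rho [:: c] /\ sym_units rho [:: c'].
      by apply/andP; rewrite -sym_units_cons.
    have [u Pu ru] := P_lift okc; have [u' Pu' ru'] := P_lift okc'.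
    move: cc0; rewrite -ru -ru' => cc0.
    have [P1 r1 P2 r2] := P_add Pu Pu' cc0.
    rewrite -r1 -r2 !fE // (wrel_add relW) //.
      by rewrite sym_units_cons !P_sym.
    by have := P_sym P1; rewrite (sym_units1 _ divE) => /andP[].
  have [u Pu ru] := P_lift ok; have [P1 r1] := P_opp Pu.
  by rewrite -ru -r1 !fE // (wrel_opp relW) // P_sym.
have [phi hphi] := witt_lift divF twoF relf.
exists phi => us Pus ok; rewrite hphi // big_map.
by apply: eq_big_seq => u /Pus Pu; rewrite fE.
Qed.

End Lifting.

(** * Valuation of the quaternion algebra *)

Section QuaternionValuation.
Variables (K : fieldType) (nu : K -> int).
Hypothesis nu_val : normalized_valuation nu.
Hypothesis nu_complete : complete_valuation nu.
Variables (k : fieldType) (rK : K -> k).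
Hypothesis rK_res : residue_map nu rK.
Hypothesis char_k : (2%:R : k) != 0.
Variables (a pi : K).
Hypotheses (a0 : a != 0) (nu_a : nu a = 0) (pi0 : pi != 0) (nu_pi : nu pi = 1).
Local Notation D := (quat a pi).
Hypothesis division : forall d : D, d != 0 -> d \is a GRing.unit.
Local Notation "c \ge n" := (val_ge nu n c) (at level 70).
Local Notation nuD := (@nuD K nu a pi).
Implicit Types d e g u : D.

Let two0 : (2%:R : K) != 0 := (nu_two nu_val rK_res char_k).1.

Lemma Nrd_neq0 d : d != 0 -> Nrd d != 0.
Proof. by move/division. Qed.

(** If the residue of [a] were the square of that of [c], then [a / c^2] would
    be a 1-unit, hence a square [e^2], and [c e + x] would have reduced norm
    0. *)
Lemma residue_nonsquare t : t ^+ 2 != rK a.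
Proof.
apply/eqP => ta; have [c hc rc] := res_surj rK_res t.
have ha : a \ge 0 by rewrite val_geE // nu_a.
have ta0 : rK a != 0 by rewrite (res_unit rK_res) // a0 nu_a eqxx.
have t0 : t != 0 by apply: contraNneq ta0 => t0; rewrite -ta t0 expr0n.
have /andP[c0 /eqP nc] : (c != 0) && (nu c == 0).
  by rewrite -(res_unit rK_res) // rc.
have hcc : c ^+ 2 \ge 0 by apply: val_geMl.
have hca : a - c ^+ 2 \ge 1.
  rewrite -val_idealE -(res_ker rK_res); last exact: val_geB.
  have hN : - c ^+ 2 \ge 0 by apply: val_geN.
  rewrite (resD rK_res) // (resN rK_res) // (resM rK_res) // rc.
  by rewrite -expr2 ta subrr.
have h1 : (a - c ^+ 2) / c ^+ 2 \ge 1.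
  apply: val_geMr => //; rewrite val_geE ?invr_eq0 ?expf_neq0 //.
  by rewrite nuV ?expf_neq0 // (Defs.valM nu_val) // nc.
have [e _ he] := hensel_sqrt nu_val rK_res char_k nu_complete h1.
pose d : D := Quat a pi (c * e) 1 0 0.
have d0 : d != 0 by apply/eqP => /quatP[_ /eqP]; rewrite /= oner_eq0.
case/eqP: (Nrd_neq0 d0); rewrite /Nrd /= exprMn he; field; exact: c0.
Qed.

(** The norm of [p + q x] from [K(x)] to [K]. *)
Definition normE (p q : K) := p ^+ 2 - a * q ^+ 2.

Lemma NrdE d : Nrd d = normE (re1 d) (imx d) - pi * normE (imy d) (imz d).
Proof. by rewrite /Nrd /normE; ring. Qed.

Lemma res_normE x y : x \ge 0 -> y \ge 0 ->
  rK (normE x y) = rK x ^+ 2 - rK a * rK y ^+ 2.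
Proof.
move=> hx hy; have ha : a \ge 0 by rewrite val_geE // nu_a.
have hx2 : x * x \ge 0 by apply: val_geMl.
have hy2 : y * y \ge 0 by apply: val_geMl.
have hay : a * (y * y) \ge 0 by apply: val_geMl.
have hN : - (a * (y * y)) \ge 0 by apply: val_geN.
by rewrite /normE !expr2 (resD rK_res) // (resN rK_res) // !(resM rK_res).
Qed.

(** After division by the entry of smaller value, the residue of the norm is a
    value of [X^2 - abar Y^2] with an entry equal to 1, nonzero since [abar] is
    not a square: [K(x) / K] is unramified. *)
Lemma normE_val p q : (p != 0) || (q != 0) -> exists m,
  [/\ normE p q != 0, nu (normE p q) = m * 2, p \ge m & q \ge m].
Proof.
move=> pq0.
(* [c] is the entry of smaller value. *)
have [c [c0 hp hq e1]] : exists c, [/\ c != 0, p / c \ge 0, q / c \ge 0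
    & p / c = 1 \/ q / c = 1].
  have h x y : x != 0 -> (y == 0) || (nu x <= nu y) -> y / x \ge 0.
    move=> x0; have [->|y0 /=] := eqVneq y 0; first by rewrite mul0r val_ge0.
    rewrite val_geE ?mulf_neq0 ?invr_eq0 // (Defs.valM nu_val) ?invr_eq0 //.
    by rewrite nuV // subr_ge0.
  have hx x : x != 0 -> x / x \ge 0 by move=> x0; rewrite mulfV ?val_ge1.
  have [p0 | p0] := boolP ((p == 0) || (q != 0) && (nu q <= nu p)).
    have q0 : q != 0 by move: p0 pq0; case: eqVneq => //= _ /andP[].
    exists q; rewrite q0 hx // mulfV //; split=> //; last by right.
    by apply: h => //; move: p0; rewrite q0.
  move: p0; rewrite negb_or => /andP[p0 qp].
  exists p; rewrite p0 hx // mulfV //; split=> //; last by left.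
  apply: h => //; move: qp; case: (eqVneq q 0) => //= _.
  by rewrite -ltNge => /ltW.
have ha : a \ge 0 by rewrite val_geE // nu_a.
have hN : normE (p / c) (q / c) \ge 0.
  by apply: val_geB => //; do !apply: val_geMl => //.
have : rK (normE (p / c) (q / c)) != 0.
  rewrite res_normE // subr_eq0.
  have rE := res1 rK_res.
  case: e1 => e1; rewrite e1 rE.
    rewrite expr1n; apply/eqP => e2.
    have r0 : rK (q / c) != 0.
      by apply: contra_eq_neq e2 => ->; rewrite expr0n mulr0 oner_eq0.
    case/eqP: (residue_nonsquare (rK (q / c))^-1).
    by rewrite -[rK a](mulfK (expf_neq0 2 r0)) -e2 mul1r exprVn.
  by rewrite expr1n mulr1 residue_nonsquare.
rewrite (res_unit rK_res) // => /andP[n0 /eqP nn].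
have eN : normE p q = c * c * normE (p / c) (q / c).
  by rewrite /normE; field; exact: c0.
exists (nu c); split.
- by rewrite eN !mulf_neq0.
- by rewrite eN !(Defs.valM nu_val) ?mulf_neq0 // nn addr0 -mulr2n mulr_natr.
- rewrite -[p](mulfVK c0); apply: val_geMl => //; by rewrite val_geE.
- rewrite -[q](mulfVK c0); apply: val_geMl => //; by rewrite val_geE.
Qed.

(** The two norms of [NrdE] have even and odd contributions to the value, so a
    lower bound on the value of [Nrd d] bounds each of them. *)
Lemma Nrd_val n d : Nrd d \ge n -> exists m m', [/\ n <= m * 2, n <= m' * 2 + 1,
  re1 d \ge m /\ imx d \ge m & imy d \ge m' /\ imz d \ge m'].
Proof.
rewrite NrdE => hd.
have [z1|] := boolP ((re1 d == 0) && (imx d == 0)).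
  case/andP: z1 hd => /eqP-> /eqP->.
  have [z2|] := boolP ((imy d == 0) && (imz d == 0)).
    case/andP: z2 => /eqP-> /eqP-> _; exists `|n|, `|n|.
    by split; rewrite ?val_ge0; lia.
  rewrite negb_and => /normE_val[m' [N0' nN' hp' hq']].
  rewrite /normE expr0n /= mulr0 subr0 sub0r -/(normE _ _) => hd.
  (* A vanishing component satisfies any bound. *)
  exists `|n|, m'; rewrite !val_ge0; split=> //; first by lia.
  have : pi * normE (imy d) (imz d) \ge n.
    by rewrite -[_ * _]opprK; apply: val_geN.
  rewrite val_geE ?mulf_neq0 // (Defs.valM nu_val) // nu_pi nN'; lia.
rewrite negb_and => /normE_val[m [N0 nN hp hq]].
have [z2|] := boolP ((imy d == 0) && (imz d == 0)).
  case/andP: z2 hd => /eqP-> /eqP-> hd.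
  exists m, `|n|; rewrite !val_ge0; split=> //; last by lia.
  move: hd; rewrite {2}/normE expr0n /= !mulr0 subr0 mulr0 subr0 val_geE //.
  by rewrite nN; lia.
rewrite negb_and => /normE_val[m' [N0' nN' hp' hq']].
have piN : pi * normE (imy d) (imz d) != 0 by rewrite mulf_neq0.
have nupiN : nu (pi * normE (imy d) (imz d)) = m' * 2 + 1.
  by rewrite (Defs.valM nu_val) // nu_pi nN' addrC.
have [] := val_ge_split nu_val N0 _ _ hd; rewrite ?oppr_eq0 // nuN // nN nupiN.
  by clear; lia.
by move=> h1 h2; exists m, m'.
Qed.

Lemma Nrd0 : Nrd (0 : D) = 0.
Proof. by rewrite /Nrd /=; ring. Qed.

Lemma OD_Nrd d : (d \in val_ring nuD) = (Nrd d \ge 0).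
Proof.
rewrite unfold_in /=; have [->|d0] := eqVneq d 0.
  by rewrite Nrd0 val_ge0.
by rewrite val_geE ?Nrd_neq0 //= /Defs.nuD pmulr_lge0 ?invr_gt0 // ler0z.
Qed.

Lemma mD_Nrd d : (d \in val_ideal nuD) = (Nrd d \ge 1).
Proof.
rewrite unfold_in /=; have [->|d0] := eqVneq d 0.
  by rewrite Nrd0 val_ge0.
by rewrite val_geE ?Nrd_neq0 //= /Defs.nuD pmulr_lgt0 ?invr_gt0 // ltr0z.
Qed.

Lemma normE_ge n p q : p \ge n -> q \ge n -> normE p q \ge n + n.
Proof.
move=> hp hq; apply: val_geB => //; first exact: val_geM.
by apply: val_geMl => //; [rewrite val_geE // nu_a | exact: val_geM].
Qed.

Lemma OD_coord d : d \in val_ring nuD <->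
  [/\ re1 d \ge 0, imx d \ge 0, imy d \ge 0 & imz d \ge 0].
Proof.
rewrite OD_Nrd; split=> [/Nrd_val[m [m' [hm hm' [h1 h2] [h3 h4]]]]|].
  by split; [move: h1|move: h2|move: h3|move: h4]; apply: val_geW; lia.
case=> h1 h2 h3 h4; rewrite NrdE.
apply: val_geB => //; first exact: (normE_ge h1 h2).
apply: val_geMl => //; first by rewrite val_geE // nu_pi.
exact: (normE_ge h3 h4).
Qed.

Lemma mD_coord d : d \in val_ideal nuD <->
  [/\ re1 d \ge 1, imx d \ge 1, imy d \ge 0 & imz d \ge 0].
Proof.
rewrite mD_Nrd; split=> [/Nrd_val[m [m' [hm hm' [h1 h2] [h3 h4]]]]|].
  by split; [move: h1|move: h2|move: h3|move: h4]; apply: val_geW; lia.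
case=> h1 h2 h3 h4; rewrite NrdE; apply: val_geB => //.
  by apply: val_geW (normE_ge h1 h2).
have : pi \ge 1 by rewrite val_geE // nu_pi.
by move=> hpi; have := val_geM nu_val hpi (normE_ge h3 h4).
Qed.

Lemma nuDM d e : d != 0 -> e != 0 -> nuD (d * e) = nuD d + nuD e.
Proof.
move=> d0 e0; rewrite /Defs.nuD NrdM (Defs.valM nu_val) ?Nrd_neq0 //.
by rewrite intrD mulrDl.
Qed.

Lemma OD_M d e :
  d \in val_ring nuD -> e \in val_ring nuD -> d * e \in val_ring nuD.
Proof. by rewrite !OD_Nrd NrdM => hd he; apply: val_geMl. Qed.

Lemma mD_Ml d e :
  d \in val_ring nuD -> e \in val_ideal nuD -> d * e \in val_ideal nuD.
Proof. by rewrite OD_Nrd !mD_Nrd NrdM => hd he; apply: val_geMl. Qed.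

Lemma OD_D d e :
  d \in val_ring nuD -> e \in val_ring nuD -> d + e \in val_ring nuD.
Proof.
move=> /OD_coord[? ? ? ?] /OD_coord[? ? ? ?].
by apply/OD_coord; split; apply: val_geD.
Qed.

Lemma OD_N d : d \in val_ring nuD -> - d \in val_ring nuD.
Proof. by move=> /OD_coord[? ? ? ?]; apply/OD_coord; split; apply: val_geN. Qed.

Lemma mD_OD d : d \in val_ideal nuD -> d \in val_ring nuD.
Proof. by rewrite mD_Nrd OD_Nrd; apply: val_geW. Qed.

Lemma OD_alg c : (c%:A \in val_ring nuD) = (c \ge 0).
Proof.
apply/idP/idP => [/OD_coord[/= h _ _ _]|h]; first by move: h; rewrite mulr1.
by apply/OD_coord; rewrite /= !mulr0 mulr1 !val_ge0.
Qed.

(** If the reduced norm of [g] is [m^2], then [(g + m)^2 = (2 re g + 2 m) g] by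
    the quadratic equation of [g].  Both [Nrd g] and [(re g + m) / 2] are
    1-units of [K], hence squares there. *)
Lemma hensel_quat g : g - 1 \in val_ideal nuD ->
  exists al be : K, (al%:A + be *: g) * (al%:A + be *: g) = g.
Proof.
move=> /mD_coord[/= h1]; rewrite !subr0 => h2 h3 h4.
have r1 : re1 g = 1 + (re1 g - 1) by ring.
have hr : re1 g \ge 0.
  by rewrite r1; apply: val_geD => //; [exact: val_ge1|exact: val_geW h1].
have ha : a \ge 0 by rewrite val_geE // nu_a.
have hpi : pi \ge 1 by rewrite val_geE // nu_pi.
have hn : Nrd g - 1 \ge 1.
  have -> : Nrd g - 1 = (re1 g - 1) * (re1 g + 1) - a * imx g ^+ 2
     - pi * normE (imy g) (imz g) by rewrite /Nrd /normE; ring.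
  apply: val_geB => //; last exact: val_geMr (normE_ge h3 h4).
  apply: val_geB => //.
    by apply: val_geMr => //; apply: val_geD => //; exact: val_ge1.
  by apply: val_geMl => //; exact: (val_geW _ (val_geM nu_val h2 h2)).
have [m hm em] := hensel_sqrt nu_val rK_res char_k nu_complete hn.
rewrite addrC subrK in em.
have ht : (re1 g - 1 + (m - 1)) / 2%:R \ge 1.
  by apply: (val_ge_half nu_val rK_res char_k); apply: val_geD.
have [e he ee] := hensel_sqrt nu_val rK_res char_k nu_complete ht.
have e0 : e != 0.
  apply/eqP => e0; move: he; rewrite e0 sub0r val_geE ?oppr_eq0 ?oner_eq0 //.
  by rewrite nuN ?oner_eq0 // nu1.
(* The square root of [g] is [(g + m) / (2 e)], since
   [(2 e)^2 = 4 (re g + m) / 2 = 2 (re g + m)]. *)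
exists (m / (2%:R * e)), (2%:R * e)^-1.
have e2 : 2%:R * e ^+ 2 = re1 g + m.
  by rewrite ee; field; exact: two0.
set f := 2%:R * e; have f0 : f != 0 by rewrite mulf_neq0.
have f2 : f ^+ 2 = 2%:R * (re1 g + m) by rewrite -e2 /f; ring.
have gg : g * g = (2%:R * re1 g) *: g - (m ^+ 2)%:A.
  by rewrite em /Nrd; apply/quatP; split=> /=; ring.
have -> : (m / f)%:A + f^-1 *: g = f^-1 *: (m%:A + g).
  by rewrite scalerDr scalerA mulrC.
rewrite -scalerAl -scalerAr scalerA mulrDl !mulrDr gg -scalerAl mul1r.
rewrite -scalerAr mulr1 -scalerAl mul1r scalerA.
have -> : (m * m)%:A + m *: g + (m *: g + ((2%:R * re1 g) *: g - (m ^+ 2)%:A))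
    = f ^+ 2 *: g by rewrite f2; apply/quatP; split=> /=; ring.
by rewrite scalerA -invfM -expr2 mulVf ?scale1r // expf_neq0.
Qed.

(** * Residues and symmetric elements of the quaternion algebra *)

Variables (L : fieldExtType k) (rD : D -> L).
Hypothesis rD_res : residue_map nuD rD.
Local Notation O := (val_ring nuD).
Local Notation m := (val_ideal nuD).
Local Notation sigma := (tau_x pi a0).

Lemma tau_xE d : sigma d = Quat a pi (re1 d) (- imx d) (imy d) (imz d).
Proof.
have Ux : qx \is a GRing.unit := qx_unit pi a0.
apply: (mulIr Ux); rewrite /= /twist_fun mulrVK //.
by apply/quatP; split=> /=; ring.
Qed.

Lemma tau_x_alg (c : K) : sigma c%:A = c%:A.
Proof. by rewrite tau_xE; apply/quatP; split=> /=; ring. Qed.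

Lemma quat_two_neq0 : (2%:R : D) != 0.
Proof. by apply/eqP => /quatP[/eqP]; rewrite /= -mulr2n (negbTE two0). Qed.

Lemma residue_two_neq0 : (2%:R : L) != 0.
Proof. by rewrite -scaler_nat scaler_eq0 negb_or char_k oner_eq0. Qed.

Lemma Nrd_tau_x d : Nrd (sigma d) = Nrd d.
Proof. by rewrite tau_xE /Nrd /=; ring. Qed.

(** With [g = u' / u], one has [g u = u' = u sigma(g)], so any [d] in [K[g]]
    satisfies [d u = u sigma(d)].  If [d^2 = g], then
    [d u sigma(d) = d^2 u = u']. *)
Lemma congruent_scaling u u' : u != 0 -> sigma u = u -> sigma u' = u' ->
  u' / u - 1 \in m -> exists2 d, d != 0 & u' = d * u * sigma d.
Proof.
move=> u0 su su' hg; have Uu := division u0.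
have [al [be]] := hensel_quat hg.
set g := u' / u; set d := al%:A + be *: g => dd.
have gu : g * u = u' by rewrite mulrVK.
have sg : sigma g = u^-1 * u' by rewrite invoM (invoV sigma Uu).1 su su'.
have du : u * sigma d = d * u.
  rewrite /d invoD -[in LHS](mulr_algl be) invoM !tau_x_alg sg mulrDr mulrDl.
  congr (_ + _); first by rewrite mulr_algl mulr_algr.
  by rewrite mulr_algr -scalerAr mulVKr // -scalerAl gu.
have eq : u' = d * u * sigma d by rewrite -mulrA du mulrA dd gu.
exists d => //; apply/eqP => d0.
move: hg; rewrite -/g -dd d0 mul0r sub0r => /mD_coord.
case=> h _ _ _; move: h; rewrite -[re1 _]/(- 1 : K).
by rewrite val_geE ?oppr_eq0 ?oner_eq0 // nuN ?oner_eq0 // nu1.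
Qed.

Lemma mD_D d e : d \in m -> e \in m -> d + e \in m.
Proof.
move=> /mD_coord[? ? ? ?] /mD_coord[? ? ? ?].
by apply/mD_coord; split; apply: val_geD.
Qed.

Lemma res_neq0 e : e \in O -> (rD e != 0) = (e != 0) && (nuD e == 0).
Proof.
move=> he; rewrite (res_ker rD_res) //; move: he; rewrite !unfold_in /= negb_or.
by have [//|_ /=] := eqVneq e 0; rewrite -leNgt eq_le andbC => ->.
Qed.

Lemma nuD1 : nuD 1 = 0.
Proof. by rewrite /Defs.nuD (_ : Nrd 1 = 1) ?nu1 ?mul0r // /Nrd /=; ring. Qed.

Lemma nuDV e : e != 0 -> nuD e^-1 = - nuD e.
Proof.
move=> e0; have Ue := division e0; apply: (addrI (nuD e)).
by rewrite -nuDM ?invr_eq0 // mulrV // nuD1 subrr.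
Qed.

Lemma O_unit e : e != 0 -> nuD e = 0 ->
  [/\ e \in O, e^-1 \in O, rD e != 0 & rD e^-1 = (rD e)^-1].
Proof.
move=> e0 ne; have Ue := division e0.
have he : e \in O by rewrite unfold_in /= ne lexx orbT.
have hV : e^-1 \in O by rewrite unfold_in /= nuDV // ne oppr0 lexx orbT.
have re : rD e != 0 by rewrite res_neq0 // e0 ne eqxx.
split=> //; apply: (mulfI re).
by rewrite -(Defs.resM rD_res) // mulrV // (res1 rD_res) mulfV.
Qed.

Lemma O_lift c : c != 0 -> exists e, [/\ e != 0, nuD e = 0, e \in O & rD e = c].
Proof.
move=> c0; have [e he re] := res_surj rD_res c.
by have := res_neq0 he; rewrite re c0 => /esym/andP[e0 /eqP ne]; exists e.
Qed.

Lemma res_sum n (F : 'I_n -> D) : (forall i, F i \in O) ->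
  \sum_i F i \in O /\ rD (\sum_i F i) = \sum_i rD (F i).
Proof.
move=> hF; apply: (big_ind2 (fun x y => x \in O /\ rD x = y)) => //.
  by rewrite val_ring0 (res0 rD_res).
move=> x1 x2 y1 y2 [h1 <-] [h2 <-]; rewrite (Defs.resD rD_res) //.
by split=> //; apply: OD_D.
Qed.

Section Uniformizer.
Variables (v : D) (rho : involution L).
Hypotheses (v0 : v != 0) (sv : sigma v = v).
Hypothesis v_rho : induces nuD rD (twist_fun sigma v) rho.

(** For [v = 1] these are the entries of unramified forms, for [v = y] those of
    ramified forms.  [layer_res] is the entry of the residue form; it is
    symmetric for the involution induced by [sigma_v]. *)
Definition layer u := [/\ sigma u = u, u != 0 & nuD u = nuD v].
Definition layer_res u := rD (u / v).

Let Uv : v \is a GRing.unit := division v0.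

Lemma twist_O d : d \in O -> twist_fun sigma v d \in O.
Proof.
rewrite !OD_Nrd /twist_fun NrdM NrdM Nrd_tau_x.
by rewrite mulrAC -NrdM mulrV // (_ : Nrd 1 = 1) ?mul1r // /Nrd /=; ring.
Qed.

Lemma layer_unit u : layer u -> u / v != 0 /\ nuD (u / v) = 0.
Proof.
case=> _ u0 nu_u; split; first by rewrite mul_neq0 // invr_eq0.
by rewrite nuDM ?invr_eq0 // nuDV // nu_u subrr.
Qed.

Lemma layerP u : sigma u = u -> u / v \in O -> layer_res u != 0 -> layer u.
Proof.
move=> su hu; rewrite /layer_res res_neq0 // => /andP[e0 /eqP ne].
have u0 : u != 0 by apply: contraNneq e0 => ->; rewrite mul0r.
split=> //; apply/eqP; rewrite -subr_eq0 -nuDV //.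
by rewrite -nuDM ?invr_eq0 // ne.
Qed.

Lemma layer_twist u : sigma u = u -> twist_fun sigma v (u / v) = u / v.
Proof.
by move=> su; rewrite /twist_fun invoM (invoV sigma Uv).1 sv su mulVKr.
Qed.

Lemma layer_sym u : layer u -> sym_units sigma [:: u].
Proof. by case=> su u0 _; rewrite sym_units1 // su eqxx. Qed.

Lemma layer_res_sym u : layer u -> sym_units rho [:: layer_res u].
Proof.
move=> Pu; have [e0 ne] := layer_unit Pu; have [he _ re _] := O_unit e0 ne.
rewrite sym_units1; last by move=> d; rewrite unitfE.
by case: Pu => su _ _; rewrite -v_rho // layer_twist // eqxx.
Qed.

(** Symmetrize an arbitrary lift: [(e v + sigma(e v)) / v] has residue
    [rD e + rho (rD e)]. *)
Lemma layer_lift c :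
  sym_units rho [:: c] -> exists2 u, layer u & layer_res u = c.
Proof.
rewrite sym_units1; last by move=> d; rewrite unitfE.
case/andP=> /eqP rc c0.
have c20 : c / 2%:R != 0 by rewrite mulf_neq0 // invr_eq0 residue_two_neq0.
have [e [e0 ne he re]] := O_lift c20.
have eE : (e * v + sigma (e * v)) / v = e + twist_fun sigma v e.
  by rewrite mulrDl mulrK // invoM sv.
have rE : layer_res (e * v + sigma (e * v)) = c.
  rewrite /layer_res eE (Defs.resD rD_res) ?twist_O // v_rho // re.
  rewrite invoM (invoV rho _).1 ?unitfE ?residue_two_neq0 // rc.
  have -> : rho 2%:R = 2%:R by rewrite [2%:R]mulr2n invoD invo1.
  rewrite [_^-1 * c]mulrC -mulrDl -mulr2n -[c *+ 2]mulr_natr.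
  by rewrite mulfK // residue_two_neq0.
exists (e * v + sigma (e * v)) => //; apply: layerP.
- by rewrite invoD invoK addrC.
- by rewrite eE OD_D ?twist_O.
by rewrite rE.
Qed.

Lemma layer_scale d u : d != 0 -> nuD d = 0 -> layer u ->
  layer (d * u * sigma d)
  /\ layer_res (d * u * sigma d) = rD d * layer_res u * rho (rD d).
Proof.
move=> d0 nd Pu; have [e0 ne] := layer_unit Pu.
have [he _ re _] := O_unit e0 ne; have [hd _ rd _] := O_unit d0 nd.
have eE : d * u * sigma d / v = d * (u / v) * twist_fun sigma v d.
  by rewrite /twist_fun !mulrA mulrVK.
have hde : d * (u / v) \in O by apply: OD_M.
have rE : layer_res (d * u * sigma d) = rD d * layer_res u * rho (rD d).
  have ht := twist_O hd.
  by rewrite /layer_res eE (Defs.resM rD_res) // (Defs.resM rD_res) // v_rho.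
split=> //; apply: layerP.
- by case: Pu => su _ _; rewrite invoM invoK invoM su mulrA.
- by rewrite eE OD_M ?twist_O.
rewrite rE !mulf_neq0 //.
by rewrite -unitfE; apply: (invoV rho _).2; rewrite unitfE.
Qed.

Lemma layer_add u u' : layer u -> layer u' -> layer_res u + layer_res u' != 0 ->
  [/\ layer (u + u'), layer_res (u + u') = layer_res u + layer_res u',
      layer (u + u / u' * u)
    & layer_res (u + u / u' * u)
        = layer_res u + layer_res u / layer_res u' * layer_res u].
Proof.
move=> Pu Pu' r0.
have [e0 ne] := layer_unit Pu; have [he _ re _] := O_unit e0 ne.
have [e0' ne'] := layer_unit Pu'; have [he' hV' re' rV'] := O_unit e0' ne'.
have [su u0 _] := Pu; have [su' u0' _] := Pu'; have Uu' := division u0'.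
have E1 : (u + u') / v = u / v + u' / v by rewrite mulrDl.
have R1 : layer_res (u + u') = layer_res u + layer_res u'.
  by rewrite /layer_res E1 (Defs.resD rD_res).
have E2 : (u + u / u' * u) / v = u / v + (u / v) * (u' / v)^-1 * (u / v).
  by rewrite mulrDl invrM ?unitrV // invrK !mulrA mulrVK.
have h2 : u / v * (u' / v)^-1 \in O by apply: OD_M.
have h3 : u / v * (u' / v)^-1 * (u / v) \in O by apply: OD_M.
have R2 : layer_res (u + u / u' * u)
    = layer_res u + layer_res u / layer_res u' * layer_res u.
  rewrite /layer_res E2 (Defs.resD rD_res) //; congr (_ + _).
  by rewrite (Defs.resM rD_res) // (Defs.resM rD_res) // rV'.
have L1 : layer (u + u').
  apply: layerP; rewrite ?R1 //; first by rewrite invoD su su'.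
  by rewrite E1 OD_D.
split=> //; apply: layerP.
- by rewrite invoD invoM invoM (invoV sigma Uu').1 su su' mulrA.
- by rewrite E2 OD_D.
rewrite R2 (_ : _ + _
  = layer_res u / layer_res u' * (layer_res u + layer_res u')).
  by rewrite !mulf_neq0 ?invr_eq0.
by rewrite mulrDr mulfVK // addrC.
Qed.

Lemma layer_opp u : layer u -> layer (- u) /\ layer_res (- u) = - layer_res u.
Proof.
move=> Pu; have [e0 ne] := layer_unit Pu; have [he _ re _] := O_unit e0 ne.
have R : layer_res (- u) = - layer_res u.
  by rewrite /layer_res mulNr (resN rD_res) ?OD_N.
have [su _ _] := Pu; split=> //; apply: layerP; first by rewrite invoN su.
  by rewrite mulNr OD_N.
by rewrite R oppr_eq0.
Qed.

Lemma layer_eq u u' : layer u -> layer u' -> layer_res u = layer_res u' ->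
  exists2 d, d != 0 & u' = d * u * sigma d.
Proof.
move=> Pu Pu' eq_r; have [su u0 _] := Pu; have [su' u0' _] := Pu'.
have [e0 ne] := layer_unit Pu; have [he hV re rV] := O_unit e0 ne.
have [e0' ne'] := layer_unit Pu'; have [he' _ re' _] := O_unit e0' ne'.
apply: congruent_scaling => //.
have -> : u' / u = u' / v * (u / v)^-1.
  by rewrite invrM ?unitrV // ?division // invrK mulrA mulrVK.
have h1 : u' / v * (u / v)^-1 \in O by apply: OD_M.
have hN : - 1 \in O by rewrite OD_N // unfold_in /= nuD1 lexx orbT.
rewrite -(res_ker rD_res) ?OD_D // (Defs.resD rD_res) // (resN rD_res) //.
  rewrite (Defs.resM rD_res) // rV -/(layer_res u') -/(layer_res u) eq_r.
  by rewrite mulfV // (res1 rD_res) subrr.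
by rewrite unfold_in /= nuD1 lexx orbT.
Qed.

Lemma layer_witt : exists phi : {additive witt rho -> witt sigma},
  forall us, {in us, forall u, layer u} ->
  phi (\sum_(c <- map layer_res us) wclass1 rho c)
    = \sum_(u <- us) wclass1 sigma u.
Proof.
have divL (d : L) : d != 0 -> d \is a GRing.unit by rewrite unitfE.
have [] := @witt_lift_residue D L sigma rho division divL residue_two_neq0
  layer layer_res layer_sym layer_lift _ _ layer_add layer_opp.
- move=> u u' Pu Pu' /(layer_eq Pu Pu')[d d0 ->].
  by rewrite (wrel_scale (wclass1_relations _ division)) // layer_sym.
- move=> d u d0 Pu; have [e [e0 ne he re]] := O_lift d0.
  by have [P1 R1] := layer_scale e0 ne Pu; exists e; rewrite R1 re.
move=> phi hphi; exists phi => us Pus; apply: hphi => //.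
apply/allP => _ /mapP[u /Pus Pu ->].
by have := layer_res_sym Pu; rewrite /sym_units /= andbT.
Qed.

(** On integral vectors, the form divided by [v] reduces to the residue form;
    if the latter is anisotropic, then only vectors in the maximal ideal can
    have a value in [m v]. *)
Lemma layer_form us (okr : sym_units rho (map layer_res us))
    (x : 'I_(size us) -> D) : {in us, forall u, layer u} ->
    (forall i, x i \in O) -> anisotropic (diag_form okr) ->
  let A := (\sum_i x i * us`_i * sigma (x i)) / v in
  A \in O /\ (A \in m -> forall i, x i \in m).
Proof.
move=> Pus hx an A; pose F i := x i * (us`_i / v) * twist_fun sigma v (x i).
have hu (i : 'I_(size us)) : us`_i / v \in O.
  have /Pus Pu : us`_i \in us by apply: mem_nth.
  by have [e0 ne] := layer_unit Pu; have [] := O_unit e0 ne.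
have hF1 i : x i * (us`_i / v) \in O by apply: OD_M.
have hF i : F i \in O by apply: OD_M => //; apply: twist_O.
have AE : A = \sum_i F i.
  rewrite /A mulr_suml; apply: eq_bigr => i _.
  by rewrite /F /twist_fun !mulrA mulrVK.
have [hA rA] := res_sum hF; rewrite AE; split=> // mA i.
have : rD (\sum_i F i) = 0 by apply/eqP; rewrite (res_ker rD_res).
rewrite rA => e.
have sz : size (map layer_res us) = size us by rewrite size_map.
pose w : 'rV[L]_(size (map layer_res us)) := \row_j rD (x (cast_ord sz j)).
have w0 : w = 0.
  apply: an; rewrite /= /diag_val (reindex (cast_ord (esym sz))) /=; last first.
    apply/onW_bij; exists (cast_ord sz); first exact: cast_ordKV.
    exact: cast_ordK.
  rewrite -[RHS]e; apply: eq_bigr => i' _.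
  rewrite !mxE cast_ordKV (nth_map 0) // /F.
  have ht := twist_O (hx i').
  by rewrite (Defs.resM rD_res) // (Defs.resM rD_res) // v_rho.
have /rowP/(_ (cast_ord (esym sz) i)) := w0.
rewrite !mxE cast_ordKV => /eqP.
by rewrite (res_ker rD_res).
Qed.

End Uniformizer.

(** * Residue field and induced involutions *)

Lemma scale_primitive n (w : 'rV[D]_n) : w != 0 -> exists2 d, d != 0 &
  (forall i, (d *: w) 0 i \in O) /\ exists i, (d *: w) 0 i = 1.
Proof.
move=> w0; have [i0 hi0] : exists i, w 0 i != 0.
  apply: contrapT => nw; case/eqP: w0; apply/rowP => i; rewrite mxE.
  by apply/eqP; apply: contrapT => hi; apply: nw; exists i; apply/negP.
case: (@Order.TotalTheory.arg_minP _ _ _ i0 (fun i => w 0 i != 0)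
  (fun i => nuD (w 0 i)) hi0) => i hi min_i.
have Ui := division hi.
exists (w 0 i)^-1; first by rewrite invr_eq0.
split; last by exists i; rewrite mxE mulVr.
move=> j; rewrite mxE; have [->|hj] := eqVneq (w 0 j) 0.
  by rewrite mulr0 val_ring0.
rewrite unfold_in /= nuDM ?invr_eq0 // nuDV // addrC subr_ge0 min_i ?orbT //.
Qed.

Lemma NrdV e : e != 0 -> Nrd e^-1 = (Nrd e)^-1.
Proof.
move=> e0; apply: (mulfI (Nrd_neq0 e0)); rewrite -NrdM mulrV ?division //.
by rewrite mulfV ?Nrd_neq0 // /Nrd /=; ring.
Qed.

Lemma nuD_eq0 e : nuD e = 0 -> nu (Nrd e) = 0.
Proof.
by move/eqP; rewrite mulf_eq0 invr_eq0 (eqr_nat _ 2 0) orbF intr_eq0 => /eqP.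
Qed.

Lemma Nrd_qy : Nrd (qy : D) = - pi.
Proof. by rewrite /Nrd /=; ring. Qed.

Lemma qy_neq0 : (qy : D) != 0.
Proof. by apply/eqP => /quatP[_ _ /eqP]; rewrite /= oner_eq0. Qed.

Lemma nuD_qy : nuD qy = 1 / 2%:R.
Proof. by rewrite /Defs.nuD Nrd_qy nuN // nu_pi. Qed.

Lemma tau_x_qy : sigma qy = qy.
Proof. by rewrite tau_xE; apply/quatP; split=> //=; rewrite oppr0. Qed.

Hypothesis rD_rK : {in val_ring nu, forall c : K, rD c%:A = (rK c)%:A}.
Local Notation X := (rD qx).

Lemma qx_O : (qx : D) \in O.
Proof. by apply/OD_coord; rewrite /= !val_ge0 val_ge1. Qed.

Lemma alg_O c : c \in val_ring nu -> (c%:A : D) \in O.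
Proof. by rewrite OD_alg. Qed.

Lemma res_coord d : d \in O ->
  rD d = (rK (re1 d))%:A + rK (imx d) *: X.
Proof.
move=> /OD_coord[h1 h2 h3 h4]; pose t : D := Quat a pi 0 0 (imy d) (imz d).
have tm : t \in m by apply/mD_coord; rewrite /= !val_ge0.
have {1}-> : d = (re1 d)%:A + ((imx d)%:A * qx + t).
  by apply/quatP; split=> /=; ring.
have H1 := alg_O h1; have H2 := alg_O h2; have H3 := OD_M H2 qx_O.
have H4 := mD_OD tm.
rewrite (Defs.resD rD_res) ?OD_D // (Defs.resD rD_res) //.
rewrite (Defs.resM rD_res) ?qx_O // !rD_rK // mulr_algl.
have -> : rD t = 0 by apply/eqP; rewrite (res_ker rD_res).
by rewrite addr0.
Qed.

Lemma res_qx_sqr : X ^+ 2 = (rK a)%:A.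
Proof.
rewrite expr2 -(Defs.resM rD_res) ?qx_O // -expr2 qxx rD_rK //.
by rewrite val_ringE val_geE // nu_a.
Qed.

Lemma residue_span l : exists s t : k, l = s%:A + t *: X.
Proof.
have [d hd <-] := res_surj rD_res l; rewrite res_coord //.
by exists (rK (re1 d)), (rK (imx d)).
Qed.

Lemma res_qx_notin1 : X \notin 1%VS.
Proof.
apply/negP => /vlineP[t et]; have := res_qx_sqr.
rewrite et exprZn expr1n => /eqP.
rewrite -subr_eq0 -scalerBl scaler_eq0 oner_eq0 orbF subr_eq0.
by apply/negP/residue_nonsquare.
Qed.

Lemma residue_field_structure :
  [/\ <<1; X>>%VS = {:L}%VS, \dim {:L} = 2%N & X ^+ 2 = (rK a)%:A].
Proof.
have e : {:L}%VS = (1 + <[X]>)%VS.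
  apply/eqP; rewrite eqEsubv subvf andbT; apply/subvP => l _.
  have [s [t ->]] := residue_span l.
  by apply: memv_add; apply: memvZ; rewrite ?mem1v ?memv_line.
split; last exact: res_qx_sqr.
  apply/eqP; rewrite eqEsubv subvf e subv_add sub1v /=.
  exact: memv_adjoin.
have : free [:: X; 1].
  by rewrite free_cons span_seq1 res_qx_notin1 seq1_free oner_eq0.
by rewrite /free span_cons span_seq1 addvC -e => /eqP.
Qed.

Variable iota : involution L.
Hypothesis iota_k : forall c : k, iota c%:A = c%:A.
Hypothesis iota_nontrivial : exists l : L, iota l <> l.

Lemma iotaZ t l : iota (t *: l) = t *: iota l.
Proof. by rewrite -mulr_algl invoM iota_k mulr_algr. Qed.

(** [iota X] is a root of the same quadratic equation as [X], and it differs
    from [X] because [iota] is not the identity. *)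
Lemma iota_qx : iota X = - X.
Proof.
have : (iota X - X) * (iota X + X) == 0.
  by rewrite -subr_sqr expr2 -invoM -expr2 res_qx_sqr iota_k subrr.
rewrite mulf_eq0 subr_eq0 addr_eq0 => /orP[|] /eqP // eX.
have [l []] := iota_nontrivial; have [s [t ->]] := residue_span l.
by rewrite invoD iota_k iotaZ eX.
Qed.

Lemma tau_x_induces : induces nuD rD sigma iota.
Proof.
move=> d hd; have hs : sigma d \in O.
  by move: hd; rewrite !OD_Nrd Nrd_tau_x.
have [_ h2 _ _] := (OD_coord d).1 hd.
rewrite (res_coord hs) (res_coord hd) tau_xE /= invoD iota_k iotaZ iota_qx.
rewrite (resN rK_res) //.
  by rewrite scaleNr scalerN.
exact: val_geN.
Qed.

Lemma twist_qyE d :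
  twist_fun sigma qy d = Quat a pi (re1 d) (imx d) (imy d) (- imz d).
Proof.
apply: (mulIr (division qy_neq0)).
rewrite /twist_fun mulrVK ?division ?qy_neq0 //.
by rewrite tau_xE; apply/quatP; split=> /=; ring.
Qed.

Lemma qz_neq0 : (qz : D) != 0.
Proof. by apply/eqP => /quatP[_ _ _ /eqP]; rewrite /= oner_eq0. Qed.

Lemma twist_qzE d :
  twist_fun tau qz d = Quat a pi (re1 d) (imx d) (imy d) (- imz d).
Proof.
apply: (mulIr (division qz_neq0)).
rewrite /twist_fun mulrVK ?division ?qz_neq0 //.
by apply/quatP; split=> /=; ring.
Qed.

Lemma twist_qy_induces : induces nuD rD (twist_fun sigma qy) id.
Proof.
move=> d hd; have ht := twist_O qy_neq0 hd.
by rewrite (res_coord ht) (res_coord hd) twist_qyE.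
Qed.

Lemma twist1_induces : induces nuD rD (twist_fun sigma 1) iota.
Proof.
by move=> d hd; rewrite /twist_fun mul1r divr1 tau_x_induces.
Qed.

(** * Larmour's isomorphism *)

Local Notation unit_layer := (layer 1).
Local Notation y_layer := (layer qy).
Local Notation idL := (id_invo L).

(** Scale an isotropic vector to be integral with some coordinate equal to 1.
    The ramified part has values in [m], so the unramified coordinates lie in
    [m]; the unramified part then has value at least 1, so it stays in [m]
    after division by [y], and the ramified coordinates lie in [m] as well. *)
Lemma springer us vs (okus : sym_units sigma us) (okvs : sym_units sigma vs)
    (ok0 : sym_units iota (map (layer_res 1) us))
    (ok1 : sym_units idL (map (layer_res qy) vs)) :
  {in us, forall u, unit_layer u} -> {in vs, forall u, y_layer u} ->
  anisotropic (diag_form ok0) -> anisotropic (diag_form ok1) ->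
  anisotropic (hsum (diag_form okus) (diag_form okvs)).
Proof.
move=> Pus Pvs an0 an1 w hw; apply/eqP/negPn/negP => w0.
have [d d0 [wO [i wi]]] := scale_primitive w0.
have hw' : hsum (diag_form okus) (diag_form okvs) (d *: w) (d *: w) = 0.
  by rewrite hformZl hformZr hw mul0r mulr0.
move: (d *: w) hw' wO wi => {hw d0 d w0}w hw wO wi.
pose x j := lsubmx w 0 j; pose y j := rsubmx w 0 j.
have hx j : x j \in O by rewrite /x mxE.
have hy j : y j \in O by rewrite /y mxE.
have [hA] := layer_form (oner_neq0 D) twist1_induces Pus hx an0.
have [hB] := layer_form (rho := idL) qy_neq0 twist_qy_induces Pvs hy an1.
rewrite !divr1; set A := \sum_i _ in hA *; set B := \sum_i _ in hB * => mB mA.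
have AB : A + B = 0 by [].
have qym : (qy : D) \in m.
  by rewrite mD_Nrd Nrd_qy val_geE ?oppr_eq0 // nuN // nu_pi.
have NO e : - e \in m -> e \in m.
  rewrite -{2}[e]opprK => /mD_coord[? ? ? ?].
  by apply/mD_coord; split; apply: val_geN.
have Uy := division qy_neq0.
have hxm : forall j, x j \in m.
  apply: mA; apply: NO.
  have -> : - A = B by apply/eqP; rewrite eqr_oppLR -addr_eq0 AB.
  by rewrite -[B](mulrVK Uy); apply: mD_Ml.
have hym : forall j, y j \in m.
  apply: mB; have -> : B = - A by apply/eqP; rewrite -addr_eq0 addrC AB.
  rewrite mulNr; apply: NO; rewrite opprK mulr_suml.
  apply: (big_ind (fun e => e \in m)).
  - by rewrite unfold_in /= eqxx.
  - exact: mD_D.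
  move=> j _; set u := (X in x j * X * _).
  have [_ u0 nu_u] : unit_layer u by apply/Pus/mem_nth.
  have hu : val_ge nu 0 (Nrd u).
    by rewrite val_geE ?Nrd_neq0 // nuD_eq0 // nu_u nuD1.
  have := hxm j.
  rewrite !mD_Nrd NrdM NrdM NrdM Nrd_tau_x NrdV ?qy_neq0 // Nrd_qy => hxj.
  have hV : val_ge nu (-1) (- pi)^-1.
    by rewrite val_geE ?invr_eq0 ?oppr_eq0 // nuV ?oppr_eq0 // nuN // nu_pi.
  have h := val_geM nu_val (val_geM nu_val (val_geM nu_val hxj hu) hxj) hV.
  by apply: val_geW h.
suff : (1 : D) \in m by rewrite unfold_in /= oner_eq0 nuD1 ltxx.
rewrite -wi; case: (splitP i) => j ej.
  by have := hxm j; rewrite /x mxE; congr (w _ _ \in m); apply: val_inj.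
by have := hym j; rewrite /y mxE; congr (w _ _ \in m); apply: val_inj.
Qed.

Let divL (d : L) : d != 0 -> d \is a GRing.unit.
Proof. by rewrite unitfE. Qed.

Lemma anisotropic_lift v (rho : involution L) : v != 0 -> sigma v = v ->
  induces nuD rD (twist_fun sigma v) rho -> forall w : witt rho,
  exists us (ok : sym_units rho (map (layer_res v) us)),
    [/\ {in us, forall u, layer v u}, anisotropic (diag_form ok)
      & w = \sum_(c <- map (layer_res v) us) wclass1 rho c].
Proof.
move=> v0 sv v_rho w; have [s oks ->] := witt_diag divL residue_two_neq0 w.
have [s0 [ok0 [an0 e0]]] := anisotropic_representative divL oks.
have [us Pus es] : exists2 us, {in us, forall u, layer v u}
    & map (layer_res v) us = s0.
  elim: (s0) (ok0) => [|c s1 IH]; first by exists [::].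
  rewrite sym_units_cons => /andP[okc /IH[us Pus <-]].
  have [u Pu <-] := layer_lift v0 sv v_rho okc; exists (u :: us) => //.
  by move=> u' /[!inE] /orP[/eqP->|/Pus].
case: _ / es ok0 an0 e0 => ok0 an0 e0; exists us, ok0; split=> //.
exact: e0 (wclass1_relations _ divL).
Qed.

Lemma half_value_element (j : int) : exists2 d : D, d != 0 & nu (Nrd d) = j.
Proof.
have [i [b [ei eb]]] : exists i b : int, j = i * 2 + b /\ (b = 0 \/ b = 1).
  exists (j %/ 2)%Z, (j %% 2)%Z; split; first exact: divz_eq.
  have := modz_ge0 j (isT : 2 != 0 :> int).
  by have := ltz_pmod j (isT : 0 < 2 :> int); clear; lia.
have [t t0 nt] := val_surj nu_val i.
have nt2 : nu (t ^+ 2) = i * 2.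
  by rewrite expr2 (Defs.valM nu_val) // nt -mulr2n mulr_natr.
case: eb => eb; rewrite ei eb.
  have e : Nrd (t%:A : D) = t ^+ 2 by rewrite /Nrd /=; ring.
  exists t%:A; last by rewrite e nt2 addr0.
  have t20 : t ^+ 2 != 0 by rewrite expf_neq0.
  by apply: contraNneq t20 => z; rewrite -e z Nrd0.
have e : Nrd (t *: qy : D) = - (pi * t ^+ 2) by rewrite /Nrd /=; ring.
have pt0 : pi * t ^+ 2 != 0 by rewrite mulf_neq0 ?expf_neq0.
exists (t *: qy); last first.
  by rewrite e nuN // (Defs.valM nu_val) ?expf_neq0 // nt2 nu_pi addrC.
by apply: contraNneq pt0 => z; rewrite -oppr_eq0 -e z Nrd0.
Qed.

(** Replacing [u] by [d u sigma(d)] changes its value by [2 nu_D(d)], which can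
    be any integer. *)
Lemma rescale_to_layer u : sym_units sigma [:: u] ->
  exists2 d, d != 0 & unit_layer (d * u * sigma d) \/ y_layer (d * u * sigma d).
Proof.
move=> ok; have := ok; rewrite sym_units1 // => /andP[/eqP su u0].
(* In terms of [nu (Nrd _)], twice the value: [Nrd u] is multiplied by
   [(Nrd d)^2], so that its valuation can be reduced modulo 2. *)
have [d d0 nd] := half_value_element (- (nu (Nrd u) %/ 2)%Z).
exists d => //; have := sym_units_scale division d0 ok.
rewrite sym_units1 // => /andP[/eqP sdu du0].
have e : nu (Nrd (d * u * sigma d)) = (nu (Nrd u) %% 2)%Z.
  rewrite NrdM NrdM Nrd_tau_x !(Defs.valM nu_val) ?mulf_neq0 ?Nrd_neq0 // nd.
  by have := divz_eq (nu (Nrd u)) 2; clear; lia.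
have [h|h] : (nu (Nrd u) %% 2)%Z = 0 \/ (nu (Nrd u) %% 2)%Z = 1.
  have := modz_ge0 (nu (Nrd u)) (isT : 2 != 0 :> int).
  by have := ltz_pmod (nu (Nrd u)) (isT : 0 < 2 :> int); clear; lia.
  by left; split=> //; rewrite nuD1 /Defs.nuD e h mul0r.
by right; split=> //; rewrite nuD_qy /Defs.nuD e h.
Qed.

Lemma larmour_split s (ok : sym_units sigma s) :
  exists us vs (okus : sym_units sigma us) (okvs : sym_units sigma vs),
    [/\ {in us, forall u, unit_layer u}, {in vs, forall u, y_layer u}
      & isometric (diag_form ok) (hsum (diag_form okus) (diag_form okvs))].
Proof.
elim: s ok => [|c s IH] ok.
  exists [::], [::], isT, isT; split=> //; apply: isometric_sym.
  exact: (diag_cat (s := [::]) (t := [::])).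
have [okc oks] : sym_units sigma [:: c] /\ sym_units sigma s.
  by apply/andP; rewrite -sym_units_cons.
have [us [vs [okus [okvs [Pus Pvs iso]]]]] := IH oks.
have [d d0 Pd] := rescale_to_layer okc.
have okd := sym_units_scale division d0 okc.
have isoc := isometric_sym (diag_scale division okc okd d0).
have {iso} iso := isometric_trans (isometric_sym (diag_cons okc oks ok))
  (hsum_isometric isoc iso).
case: Pd => Pd.
  have okus' : sym_units sigma (d * c * sigma d :: us).
    by rewrite sym_units_cons okd.
  exists (d * c * sigma d :: us), vs, okus', okvs; split=> //.
    by move=> u /[!inE] /orP[/eqP->|/Pus].
  apply: isometric_trans iso _; apply: isometric_trans (hsumA _ _ _) _.
  by apply: hsum_isometric (diag_cons _ _ _) (isometric_refl _).
have okvs' : sym_units sigma (d * c * sigma d :: vs).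
  by rewrite sym_units_cons okd.
exists us, (d * c * sigma d :: vs), okus, okvs'; split=> //.
  by move=> u /[!inE] /orP[/eqP->|/Pvs].
apply: isometric_trans iso _; apply: isometric_trans (hsumA _ _ _) _.
apply: isometric_trans (hsum_isometric (hsumC _ _) (isometric_refl _)) _.
apply: isometric_trans (isometric_sym (hsumA _ _ _)) _.
exact: hsum_isometric (isometric_refl _) (diag_cons _ _ _).
Qed.

(** The value on diagonal forms that characterizes Larmour's map. *)
Definition residue_values (partial : witt sigma -> witt iota * witt idL) :=
  forall us vs,
    {in us, forall u, unit_layer u} -> {in vs, forall u, y_layer u} ->
    partial (\sum_(u <- us) wclass1 sigma u + \sum_(u <- vs) wclass1 sigma u)
      = (\sum_(c <- map (layer_res 1) us) wclass1 iota c,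
         \sum_(c <- map (layer_res qy) vs) wclass1 idL c).

Lemma larmour_iso :
  exists partial : {additive witt sigma -> witt iota * witt idL},
    bijective partial /\ residue_values partial.
Proof.
have s1 : sigma 1 = 1 := invo1 sigma.
have [phi0 h0] := layer_witt (oner_neq0 D) s1 twist1_induces.
have [phi1 h1] := layer_witt (rho := idL) qy_neq0 tau_x_qy twist_qy_induces.
pose lam (p : witt iota * witt idL) := phi0 p.1 + phi1 p.2.
have lamB p q : lam (p - q) = lam p - lam q.
  by rewrite /lam !raddfB /= opprD addrACA.
have lam0 p : lam p = 0 -> p = 0.
  case: p => w0 w1; rewrite /lam /=.
  have [us [ok0 [Pus an0 ->]]] :=
    anisotropic_lift (oner_neq0 D) s1 twist1_induces w0.
  have [vs [ok1 [Pvs an1 ->]]] :=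
    anisotropic_lift (rho := idL) qy_neq0 tau_x_qy twist_qy_induces w1.
  rewrite h0 // h1 //.
  have okus : sym_units sigma us.
    by apply/allP => u /Pus/layer_sym; rewrite /sym_units /= andbT.
  have okvs : sym_units sigma vs.
    by apply/allP => u /Pvs/layer_sym; rewrite /sym_units /= andbT.
  rewrite -(wclass_diag okus) -(wclass_diag okvs) -wclassD => /wclassP.
  move=> /(anisotropic_witt0 division (springer Pus Pvs an0 an1)) /= /eqP.
  by rewrite addn_eq0 !size_eq0 => /andP[/eqP-> /eqP->]; rewrite !big_nil.
have lam_inj : injective lam.
  move=> p q e; apply/eqP; rewrite -subr_eq0; apply/eqP/lam0.
  by rewrite lamB e subrr.
have /choice[inv invK] w : exists p, lam p = w.
  have [s ok ->] := witt_diag division quat_two_neq0 w.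
  have [us [vs [okus [okvs [Pus Pvs iso]]]]] := larmour_split ok.
  exists (\sum_(c <- map (layer_res 1) us) wclass1 iota c,
          \sum_(c <- map (layer_res qy) vs) wclass1 idL c).
  rewrite /lam /= h0 // h1 // -(wclass_diag okus) -(wclass_diag okvs).
  by rewrite -(wclass_diag ok) -wclassD; apply/esym/wclassP/isometric_witt.
have invB : zmod_morphism inv.
  by move=> v w; apply: lam_inj; rewrite lamB !invK.
pose pa : {additive witt sigma -> witt iota * witt idL} :=
  HB.pack inv (GRing.isZmodMorphism.Build _ _ inv invB).
exists pa; split.
  by exists lam => [w|p]; [exact: invK | apply: lam_inj; exact: invK].
move=> us vs Pus Pvs; apply: lam_inj.
by rewrite [LHS]invK /lam /= h0 // h1.
Qed.

(** * One-dimensional forms *)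

(** Only the invariance of rank 1 is at stake: the image of a line is spanned
    by one vector, and two basis vectors are not multiples of the same one. *)
Lemma rank1_diagonal h s (ok : sym_units sigma s) :
  hdim h = 1%N -> isometric h (diag_form ok) -> exists u, s = [:: u].
Proof.
case: h => dh hv hl hh hn /= edh; case: _ / (esym edh) hv hl hh hn.
move=> hv hl hh hn [f [[g fg gf] _]].
case: s ok f g fg gf => [|u [|u' s]] ok f g fg gf; last 2 first.
- by exists u.
- have gen x : exists t, x = t *: f 1.
    exists (g x 0 0); rewrite -linearZ -[LHS]gf; congr (f _).
    by apply/rowP => i; rewrite !ord1 !mxE eqxx mulr1.
  pose i1 : 'I_(size s).+2 := lift ord0 ord0.
  have [t0 /rowP e0] := gen (delta_mx 0 ord0).
  have [t1 /rowP e1] := gen (delta_mx 0 i1).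
  have := e0 i1; have := e0 ord0; have := e1 i1; rewrite !mxE /=.
  move: (f 1) => w {e0 e1 gen} e11 e00 e01.
  have wn : t0 != 0 by apply: contra_eq_neq e00 => ->; rewrite mul0r oner_eq0.
  have w1 : w 0 i1 = 0 by apply: (mulrI (division wn)); rewrite mulr0.
  by move/eqP: e11; rewrite w1 mulr0 oner_eq0.
have /rowP/(_ 0)/eqP : 1 = 0 :> 'rV[D]_1.
  rewrite -[1]fg -[0]fg; congr (g _).
  by rewrite (thinmx0 (f 1)) (thinmx0 (f 0)).
by rewrite !mxE oner_eq0.
Qed.

(** The scalar is the real part of [u], which has the same residue. *)
Lemma unit_layer_scalar u : unit_layer u ->
  exists delta : K, exists2 d, d != 0 &
  [/\ delta != 0, nu delta = 0 & delta%:A = d * u * sigma d].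
Proof.
move=> Pu; have [su u0 nu_u] := Pu; rewrite nuD1 in nu_u.
have [hu _ ru _] := O_unit u0 nu_u; have [h1 _ _ _] := (OD_coord u).1 hu.
have hp := alg_O h1.
have ix : imx u = 0.
  have /(congr1 (@imx _ _ _)) := su; rewrite tau_xE /= => /esym/eqP.
  by rewrite -addr_eq0 -mulr2n -mulr_natr mulf_eq0 (negbTE two0) orbF => /eqP.
have eu : rD u = rD (re1 u)%:A.
  by rewrite res_coord // ix (res0 rK_res) scale0r addr0 rD_rK.
have Pp : unit_layer (re1 u)%:A.
  by apply: (layerP (oner_neq0 D)); rewrite ?tau_x_alg /layer_res ?divr1 -?eu.
have [] := layer_eq (oner_neq0 D) Pu Pp; first by rewrite /layer_res !divr1.
move=> d d0 ed; exists (re1 u), d => //; split=> //.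
  by apply: contraNneq ru => p0; rewrite eu p0 scale0r (res0 rD_res).
have := ru; rewrite eu rD_rK // scaler_eq0 oner_eq0 orbF (res_unit rK_res) //.
by case/andP=> _ /eqP.
Qed.

(** The new element drops the real part [p] of [u]: as [p] lies in the maximal
    ideal of [K], the value of [p / y] is positive. *)
Lemma y_layer_normal u : y_layer u ->
  exists beta gamma : K, exists2 d, d != 0 &
  [/\ beta \in val_ring nu, gamma \in val_ring nu,
      beta%:A + gamma *: qx != 0 :> D, nuD (beta%:A + gamma *: qx) = 0
    & beta *: qy + gamma *: qz = d * u * sigma d].
Proof.
move=> Pu; have [su u0 nu_u] := Pu.
have [e0 ne] := layer_unit qy_neq0 Pu; have [he _ re _] := O_unit e0 ne.
have um : u \in m by rewrite unfold_in /= nu_u nuD_qy orbT.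
have [h1 _ h3 h4] := (mD_coord u).1 um.
have ix : imx u = 0.
  have /(congr1 (@imx _ _ _)) := su; rewrite tau_xE /= => /esym/eqP.
  by rewrite -addr_eq0 -mulr2n -mulr_natr mulf_eq0 (negbTE two0) orbF => /eqP.
have Uy := division qy_neq0.
pose e : D := (imy u)%:A + imz u *: qx; pose w : D := imy u *: qy + imz u *: qz.
have wE : w = e * qy by apply/quatP; split=> /=; ring.
have uE : u = (re1 u)%:A + w by apply/quatP; split=> /=; rewrite ?ix; ring.
have ew : w / qy = e by rewrite wE mulrK.
have eO : e \in O.
  by apply/OD_coord; rewrite /= !(mulr0, mulr1, addr0, add0r) !val_ge0.
have pm : (re1 u)%:A / qy \in m.
  rewrite mD_Nrd NrdM NrdV ?qy_neq0 // Nrd_qy.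
  have -> : Nrd ((re1 u)%:A : D) = re1 u * re1 u by rewrite /Nrd /=; ring.
  have hV : val_ge nu (-1) (- pi)^-1.
    by rewrite val_geE ?invr_eq0 ?oppr_eq0 // nuV ?oppr_eq0 // nuN // nu_pi.
  by apply: val_geW (val_geM nu_val (val_geM nu_val h1 h1) hV).
have rw : layer_res qy u = layer_res qy w.
  have pO := mD_OD pm; have p0 : rD ((re1 u)%:A / qy) = 0.
    by apply/eqP; rewrite (res_ker rD_res).
  by rewrite /layer_res uE mulrDl ew (Defs.resD rD_res) // p0 add0r.
have := re; rewrite -/(layer_res qy u) rw /layer_res ew res_neq0 //.
move=> /andP[e1 /eqP ne1].
have Pw : y_layer w.
  apply: (layerP qy_neq0); rewrite ?ew // -?rw //.
  by rewrite tau_xE; apply/quatP; split=> /=; ring.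
have [d d0 ed] := layer_eq qy_neq0 Pu Pw rw.
by exists (imy u), (imz u), d.
Qed.

Lemma unit_layers us : sym_units sigma us -> {in us, forall u, nuD u = 0} ->
  {in us, forall u, unit_layer u}.
Proof.
move=> ok hu u uu; have := sym_units_mem ok uu.
by rewrite sym_units1 // => /andP[/eqP su u0]; split=> //; rewrite hu // nuD1.
Qed.

Lemma y_layers us : sym_units sigma us ->
  {in us, forall u, nuD u = 1 / 2%:R} -> {in us, forall u, y_layer u}.
Proof.
move=> ok hu u uu; have := sym_units_mem ok uu.
by rewrite sym_units1 // => /andP[/eqP su u0]; split=> //; rewrite hu // nuD_qy.
Qed.

Lemma sym_units_layer v (rho : involution L) us : v != 0 -> sigma v = v ->
  induces nuD rD (twist_fun sigma v) rho ->
  {in us, forall u, layer v u} -> sym_units rho (map (layer_res v) us).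
Proof.
move=> v0 sv v_rho Pus; apply/allP => _ /mapP[u /Pus Pu ->].
by have := layer_res_sym v0 sv v_rho Pu; rewrite /sym_units /= andbT.
Qed.

Lemma map_layer_res1 us : map (layer_res 1) us = map rD us.
Proof. by apply: eq_map => u; rewrite /layer_res divr1. Qed.

Lemma residue_values_larmour partial :
  residue_values partial -> larmour_map nuD qy rD partial.
Proof.
move=> hp; split.
  move=> h; have [s [ok iso]] := diagonalization division quat_two_neq0 h.
  have [us [vs [okus [okvs [Pus Pvs iso']]]]] := larmour_split ok.
  exists (diag_form okus), (diag_form okvs); split.
  - exists us, okus; split; last exact: isometric_refl.
    by move=> u /Pus[_ _]; rewrite nuD1.
  - exists vs, okvs; split; last exact: isometric_refl.
    by move=> u /Pvs[_ _]; rewrite nuD_qy.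
  exact: isometric_trans iso iso'.
move=> us vs okus okvs hu hv.
have Pus := unit_layers okus hu; have Pvs := y_layers okvs hv.
have ok0 := sym_units_layer (oner_neq0 D) (invo1 sigma) twist1_induces Pus.
have ok1 := sym_units_layer (rho := idL) qy_neq0 tau_x_qy twist_qy_induces Pvs.
rewrite map_layer_res1 in ok0; exists ok0, ok1.
by rewrite wclassD !wclass_diag hp // map_layer_res1.
Qed.

Lemma unramified_rank1 h : hdim h = 1%N -> unramified nuD h ->
  exists (delta : K) (ok : sym_units sigma [:: delta%:A]),
    [/\ delta != 0, nu delta = 0 & isometric h (diag_form ok)].
Proof.
move=> h1 [s [ok [vs iso]]]; have [u es] := rank1_diagonal h1 iso.
case: _ / (esym es) ok vs iso => ok vs iso.
have Pu := unit_layers ok vs (mem_head u [::]).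
have [delta [d d0 [de0 nde ed]]] := unit_layer_scalar Pu.
have okd := sym_units_scale division d0 ok.
have isod :=
  isometric_trans iso (isometric_sym (diag_scale division ok okd d0)).
by case: _ / ed okd isod => okd isod; exists delta, okd.
Qed.

Lemma ramified_rank1 h : hdim h = 1%N -> ramified nuD h ->
  exists (beta gamma : K)
      (ok : sym_units sigma [:: beta *: qy + gamma *: qz]),
    [/\ beta \in val_ring nu, gamma \in val_ring nu,
        beta%:A + gamma *: qx != 0 :> D, nuD (beta%:A + gamma *: qx) = 0
      & isometric h (diag_form ok)].
Proof.
move=> h1 [s [ok [vs iso]]]; have [u es] := rank1_diagonal h1 iso.
case: _ / (esym es) ok vs iso => ok vs iso.
have Pu := y_layers ok vs (mem_head u [::]).
have [beta [gamma [d d0 [hb hg bg0 nbg ed]]]] := y_layer_normal Pu.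
have okd := sym_units_scale division d0 ok.
have isod :=
  isometric_trans iso (isometric_sym (diag_scale division ok okd d0)).
by case: _ / ed okd isod => okd isod; exists beta, gamma, okd.
Qed.

Lemma unramified_value partial h (delta : K)
    (ok : sym_units sigma [:: delta%:A]) :
  residue_values partial -> delta != 0 -> nu delta = 0 ->
  isometric h (diag_form ok) ->
  exists okbar : sym_units iota [:: (rK delta)%:A],
    (partial (wclass h)).1 = wclass (diag_form okbar).
Proof.
move=> hp d0 nd iso.
have dO : delta \in val_ring nu by rewrite val_ringE val_geE // nd.
have Pus : {in [:: delta%:A], forall u, unit_layer u}.
  apply: unit_layers => // u /[!inE] /eqP ->; rewrite /Defs.nuD.
  have -> : Nrd (delta%:A : D) = delta * delta by rewrite /Nrd /=; ring.
  by rewrite (Defs.valM nu_val) // nd mul0r.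
have := sym_units_layer (oner_neq0 D) (invo1 sigma) twist1_induces Pus.
have er : map (layer_res 1) [:: delta%:A] = [:: (rK delta)%:A].
  by rewrite /= /layer_res divr1 rD_rK.
rewrite er => okbar; exists okbar.
have -> : wclass h = \sum_(u <- [:: delta%:A]) wclass1 sigma u
    + \sum_(u <- [::]) wclass1 sigma u.
  by rewrite big_nil addr0 -(wclass_diag ok); apply/wclassP/isometric_witt.
by rewrite hp // er (wclass_diag okbar).
Qed.

Lemma ramified_value partial h (beta gamma : K)
    (ok : sym_units sigma [:: beta *: qy + gamma *: qz]) :
  residue_values partial -> beta \in val_ring nu -> gamma \in val_ring nu ->
  beta%:A + gamma *: qx != 0 :> D -> nuD (beta%:A + gamma *: qx) = 0 ->
  isometric h (diag_form ok) ->
  exists okbar : sym_units idL [:: (rK beta)%:A + rK gamma *: X],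
    (partial (wclass h)).2 = wclass (diag_form okbar).
Proof.
move=> hp hb hg e0 ne iso; set e : D := beta%:A + gamma *: qx in e0 ne *.
set w := beta *: qy + gamma *: qz in ok iso *.
have wE : w = e * qy by apply/quatP; split=> /=; ring.
have Pvs : {in [:: w], forall u, y_layer u}.
  apply: y_layers => // u /[!inE] /eqP ->.
  by rewrite wE nuDM // ?qy_neq0 // ne add0r nuD_qy.
have := sym_units_layer (rho := idL) qy_neq0 tau_x_qy twist_qy_induces Pvs.
have er : map (layer_res qy) [:: w] = [:: (rK beta)%:A + rK gamma *: X].
  rewrite /= /layer_res wE mulrK ?division ?qy_neq0 // res_coord /=.
    by rewrite !(mulr0, mulr1, addr0, add0r).
  by have [] := O_unit e0 ne.
rewrite er => okbar; exists okbar.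
have -> : wclass h = \sum_(u <- [::]) wclass1 sigma u
    + \sum_(u <- [:: w]) wclass1 sigma u.
  by rewrite big_nil add0r -(wclass_diag ok); apply/wclassP/isometric_witt.
by rewrite hp // er (wclass_diag okbar).
Qed.

Lemma qy_uniformizer : symmetric_uniformizer nuD sigma qy.
Proof. by split; [exact: tau_x_qy | exact: nuD_qy]. Qed.

End QuaternionValuation.

Theorem mainTheorem12
  (K : fieldType) (nu : K -> int)
  (nu_val : normalized_valuation nu) (nu_complete : complete_valuation nu)
  (k : fieldType) (rK : K -> k) (rK_res : residue_map nu rK)
  (char_k : (2%:R : k) != 0)
  (a : K) (a0 : a != 0) (nu_a : nu a = 0)
  (pi : K) (pi0 : pi != 0) (nu_pi : nu pi = 1)
  (division : forall d : quat a pi, d != 0 -> d \is a GRing.unit)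
  (L : fieldExtType k) (rD : quat a pi -> L)
  (rD_res : residue_map (@nuD K nu a pi) rD)
  (rD_rK : {in val_ring nu, forall c : K, rD c%:A = (rK c)%:A})
  (iota : involution L) (iota_k : forall c : k, iota c%:A = c%:A)
  (iota_nontrivial : exists l : L, iota l <> l) :
  [/\ [/\ <<1; rD qx>>%VS = {:L}%VS, \dim {:L} = 2%N
         & rD qx ^+ 2 = (rK a)%:A],
      induces (@nuD K nu a pi) rD (tau_x pi a0) iota,
      [/\ symmetric_uniformizer (@nuD K nu a pi) (tau_x pi a0) qy,
          twist_fun (tau_x pi a0) qy =1 twist_fun tau qz
        & induces (@nuD K nu a pi) rD (twist_fun (tau_x pi a0) qy) id]
    & exists partial :
        {additive witt (tau_x pi a0) -> witt iota * witt (id_invo L)},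
      [/\ larmour_map (@nuD K nu a pi) qy rD partial,
          bijective partial,
          forall h : hform (tau_x pi a0), hdim h = 1%N ->
            unramified (@nuD K nu a pi) h ->
            (exists (delta : K) (ok : sym_units (tau_x pi a0) [:: delta%:A]),
               [/\ delta != 0, nu delta = 0 & isometric h (diag_form ok)])
            /\
            (forall (delta : K) (ok : sym_units (tau_x pi a0) [:: delta%:A]),
               delta != 0 -> nu delta = 0 -> isometric h (diag_form ok) ->
               exists okbar : sym_units iota [:: (rK delta)%:A],
                 (partial (wclass h)).1 = wclass (diag_form okbar))
        & forall h : hform (tau_x pi a0), hdim h = 1%N ->
            ramified (@nuD K nu a pi) h ->
            (exists (beta gamma : K)
                (ok : sym_units (tau_x pi a0) [:: beta *: qy + gamma *: qz]),
               [/\ beta \in val_ring nu, gamma \in val_ring nu,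
                   beta%:A + gamma *: qx != 0 :> quat a pi,
                   nuD nu (beta%:A + gamma *: qx : quat a pi) = 0
                 & isometric h (diag_form ok)])
            /\
            (forall (beta gamma : K)
                (ok : sym_units (tau_x pi a0) [:: beta *: qy + gamma *: qz]),
               beta \in val_ring nu -> gamma \in val_ring nu ->
               beta%:A + gamma *: qx != 0 :> quat a pi ->
               nuD nu (beta%:A + gamma *: qx : quat a pi) = 0 ->
               isometric h (diag_form ok) ->
               exists okbar : sym_units (id_invo L)
                                [:: (rK beta)%:A + rK gamma *: rD qx],
                 (partial (wclass h)).2 = wclass (diag_form okbar))]].
Proof.
have [partial [partial_bij partial_values]] := larmour_iso nu_val nu_complete
  rK_res char_k a0 nu_a pi0 nu_pi division rD_res rD_rK iota_k iota_nontrivial.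
split.
- by apply: (residue_field_structure (nu := nu)).
- exact (tau_x_induces nu_val nu_complete rK_res char_k a0 nu_a pi0 nu_pi
    division rD_res rD_rK iota_k iota_nontrivial).
- split; first exact: qy_uniformizer.
    by move=> d; rewrite twist_qyE // twist_qzE.
  exact (twist_qy_induces nu_val nu_complete rK_res char_k a0 nu_a pi0 nu_pi
    division rD_res rD_rK).
exists partial; split=> // [|h h1 hu|h h1 hr].
- exact (residue_values_larmour nu_val nu_complete rK_res char_k nu_a pi0 nu_pi
    division rD_res rD_rK iota_k iota_nontrivial partial_values).
- split; first exact (unramified_rank1 nu_val nu_complete rK_res char_k nu_a
    pi0 nu_pi division rD_res rD_rK h1 hu).
  move=> delta ok delta0 nu_delta; exact (unramified_value nu_val nu_complete
    rK_res char_k nu_a pi0 nu_pi division rD_res rD_rK iota_k iota_nontrivial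
    partial_values delta0 nu_delta).
split; first exact (ramified_rank1 nu_val nu_complete rK_res char_k nu_a pi0
  nu_pi division rD_res h1 hr).
move=> beta gamma ok hb hg e0 ne; exact (ramified_value nu_val nu_complete
  rK_res char_k nu_a pi0 nu_pi division rD_res rD_rK partial_values
  hb hg e0 ne).
Qed.
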